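(* Let $\{X(u,s): s\ge0,\ u\in[0,1]\}$ be an Arratia flow with zero drift and let $t\in(0,1]$ be fixed. Let $U^{(n)}=(u^{(n)}_1<\ldots<u^{(n)}_n)$, $n\ge2$, be vectors with $u^{(n)}_1=0$, $u^{(n)}_n=1$, with $\{u^{(n)}_1,\ldots,u^{(n)}_n\}\subset\{u^{(n+1)}_1,\ldots,u^{(n+1)}_{n+1}\}$ for all $n$, and $\lim_{n\to\infty}\max_{1\le j\le n-1}(u^{(n)}_{j+1}-u^{(n)}_j)=0$. Then for every $k\in\mathbb{N}$ $$ p^k_t(U^{(n)};\cdot)\nearrow p^k_t,\quad n\to\infty,\quad\text{a.e. on }\mathbb{R}^k, $$ i.e. for almost every $y\in\mathbb{R}^k$ the sequence $p^k_t(U^{(n)};y)$, $n\ge\max(k,2)$, is nondecreasing and converges to $p^k_t(y)$.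
   Context: Arratia flow with zero drift: a random field $\{X(u,s)\}$, nondecreasing in $u$, such that for any finite set of points $u_1,\ldots,u_m$ the processes $X(u_1,\cdot),\ldots,X(u_m,\cdot)$ are coalescing standard Brownian motions started at $u_1,\ldots,u_m$ (independent before meeting, moving together after meeting). Put $X_t=\{X(u,t):u\in[0,1]\}$. The $k$-point density $p^k_t$ of the flow is the measurable function on $\mathbb{R}^k$ such that for every bounded nonnegative measurable $f:\mathbb{R}^k\to\mathbb{R}$ $$\int_{\mathbb{R}^k}f(x)p^k_t(x)\,dx=\mathrm{E}\sum_{v_1,\ldots,v_k\in X_t,\ \text{all distinct}}f(v_1,\ldots,v_k)$$ (sum over ordered $k$-tuples of distinct points). Coalescence scheme: for $x=(x_1<\ldots<x_n)$, let $l$ be the number of distinct values among $X(x_1,t),\ldots,X(x_n,t)$. If $l=n$, $J_t(x)=\emptyset$. If $l<n$, start from the system $\mathcal{X}^n=(X(x_1,\cdot),\ldots,X(x_n,\cdot))$; let $\tau_1\le t$ be the first collision time and $j_1$ the smallest index of a coordinate participating in this collision; delete the $j_1$-th coordinate to get $\mathcal{X}^{n-1}$ (coordinates renumbered $1,\ldots,n-1$); repeat with $\mathcal{X}^{n-1}$ to get $j_2$, and so on, $n-l$ times. Then $J_t(x)=(j_1,\ldots,j_{n-l})$, where $j_i\in\{1,\ldots,n-i\}$. $\mathcal{J}_{n,r}$ denotes the set of all possible such collections consisting of $r$ numbers ($\mathcal{J}_{n,0}=\{\emptyset\}$). For $J\in\mathcal{J}_{n,n-l}$ and $k\le l$, the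 $k$-point density $p^{J,k}_t(x;\cdot)$ corresponding to $J$ and the start points $x$ is the measurable function on $\mathbb{R}^k$ such that for every bounded nonnegative measurable $f:\mathbb{R}^k\to\mathbb{R}$ $$\int_{\mathbb{R}^k}p^{J,k}_t(x;y)f(y)\,dy=\mathrm{E}\sum_{v_1,\ldots,v_k\in\{X(x_1,t),\ldots,X(x_n,t)\},\ \text{all distinct}}f(v_1,\ldots,v_k)\,\mathbf{1}(J_t(x)=J).$$ Finally, $p^k_t(U^{(n)};\cdot)=\sum_{i=k}^{n}\sum_{J\in\mathcal{J}_{n,n-i}}p^{J,k}_t(U^{(n)};\cdot)$, $1\le k\le n$.
   Formalization: The flow X(u,s) is additionally assumed right-continuous in u (the usual càdlàg version), with path properties for every outcome; without this, altering X at a random jump point u of X(·,t) adds points to X_t, makes p^k_t too large, and the claim fails. *)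

(* Defs.v *)
From HB Require Import structures.
From mathcomp Require Import all_boot all_order all_algebra.
From mathcomp Require Import all_classical all_reals all_analysis.
Set Implicit Arguments.
Unset Strict Implicit.
Unset Printing Implicit Defensive.
Import Order.TTheory GRing.Theory Num.Theory.
Import numFieldNormedType.Exports.
Local Open Scope classical_set_scope.
Local Open Scope ring_scope.

Section LebesgueTuple.
Context (R : realType).
Local Open Scope ereal_scope.

Definition cons_pair (k : nat) (xy : R * k.-tuple R) : k.+1.-tuple R :=
  [tuple of xy.1 :: xy.2].

Definition split_pair (k : nat) (v : k.+1.-tuple R) : R * k.-tuple R :=
  (thead v, [tuple of behead v]).

Lemma cons_pairK k : cancel (@cons_pair k) (@split_pair k).
Proof. by case=> x y; congr pair => //; apply: val_inj. Qed.

Lemma measurable_cons_pair k : measurable_fun setT (@cons_pair k).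
Proof. exact: measurable_cons. Qed.

Lemma measurable_split_pair k : measurable_fun setT (@split_pair k).
Proof.
apply/measurable_fun_pair; last exact: measurable_behead.
exact: measurable_tnth.
Qed.

Section step.
Context (k : nat) (m : {sigma_finite_measure set (k.-tuple R) -> \bar R}).

Definition lebesgue_cons : set (k.+1.-tuple R) -> \bar R :=
  pushforward (@lebesgue_measure R \x m) (@cons_pair k).

Let lebesgue_cons0 : lebesgue_cons set0 = 0.
Proof. by rewrite /lebesgue_cons /pushforward preimage_set0 measure0. Qed.

Let lebesgue_cons_ge0 A : 0 <= lebesgue_cons A.
Proof. exact: (measure_ge0 (@lebesgue_measure R \x m)). Qed.

Let lebesgue_cons_sigma_additive : semi_sigma_additive lebesgue_cons.
Proof.
move=> F mF tF mUF; rewrite /lebesgue_cons /pushforward preimage_bigcup.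
have mpre A : measurable A -> measurable (@cons_pair k @^-1` A).
  by move=> mA; rewrite -[X in measurable X]setTI; exact: measurable_cons_pair.
apply: measure_semi_sigma_additive.
- by move=> n; exact: mpre.
- apply/trivIsetP => /= i j _ _ ij; rewrite -preimage_setI.
  by move/trivIsetP : tF => /(_ _ _ _ _ ij) ->//; rewrite preimage_set0.
- by rewrite -preimage_bigcup; exact: mpre.
Qed.

HB.instance Definition _ := isMeasure.Build _ _ _ lebesgue_cons
  lebesgue_cons0 lebesgue_cons_ge0 lebesgue_cons_sigma_additive.

Let lebesgue_cons_sigma_finite : sigma_finite setT lebesgue_cons.
Proof.
have /sigma_finiteP[F [TF ndF Foo]] := sigma_finiteT (@lebesgue_measure R).
have /sigma_finiteP[G [TG ndG Goo]] := sigma_finiteT m.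
exists (fun n => @split_pair k @^-1` (F n `*` G n)).
  rewrite -preimage_bigcup (_ : \bigcup_i _ = setT) ?preimage_setT//.
  rewrite -setXTT TF TG predeqE => -[x y]; split.
    by move=> [n _ []/= ? ?]; split; exists n.
  move=> [/= [n _ Fnx] [l _ Gly]]; exists (maxn n l) => //; split.
  - by move: x Fnx; exact/subsetPset/ndF/leq_maxl.
  - by move: y Gly; exact/subsetPset/ndG/leq_maxr.
move=> n; have [mF Fn] := Foo n; have [mG Gn] := Goo n; split.
  rewrite -[X in measurable X]setTI.
  by apply: measurable_split_pair => //; exact: measurableX.
rewrite /lebesgue_cons /pushforward -comp_preimage.
rewrite (_ : _ \o _ = id) ?preimage_id; last exact/funext/cons_pairK.
by rewrite product_measure1E// lte_mul_pinfty// ge0_fin_numE.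
Qed.

HB.instance Definition _ := Measure_isSigmaFinite.Build _ _ _ lebesgue_cons
  lebesgue_cons_sigma_finite.

End step.

(* Lebesgue measure on R^k, represented by k.-tuple R with its product (Borel)
   sigma-algebra; R^0 is a point of mass 1.                                   *)
Fixpoint lebesgue_tuple (k : nat) :
    {sigma_finite_measure set (k.-tuple R) -> \bar R} :=
  match k with
  | 0 => \d_([tuple] : 0.-tuple R)
  | k'.+1 => lebesgue_cons (lebesgue_tuple k')
  end.

End LebesgueTuple.

Section BrownianMotion.
Context (R : realType).

(* Processes are functions of a real time, of which only s >= 0 matters.      *)
Record brownian_motion d (Omega : measurableType d) (P : probability Omega R)
    (x : R) (W : R -> Omega -> R) : Prop := {
  bm_measurable : forall s : R, 0 <= s -> measurable_fun setT (W s) ;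
  bm_start : forall w, W 0 w = x ;
  bm_continuous : forall w, {within `[0, +oo[, continuous (W ^~ w)} ;
  bm_normal : forall (s t : R) (B : set R), 0 <= s -> s < t -> measurable B ->
    P [set w | B (W t w - W s w)] = normal_prob 0 (Num.sqrt (t - s)) B ;
  bm_independent_increments :
    forall (q : nat) (s : nat -> R) (B : nat -> set R),
    0 <= s 0%N -> (forall j, (j < q)%N -> s j <= s j.+1) ->
    (forall j, measurable (B j)) ->
    P [set w | forall j, (j < q)%N -> B j (W (s j.+1) w - W (s j) w)] =
    (\prod_(j < q) P [set w | B j (W (s j.+1) w - W (s j) w)%R])%E
}.

(* Mutual independence of W 0, ..., W m.-1 as processes: the product rule on
   the finite-dimensional cylinders, which form a pi-system generating the
   sigma-algebra of each process.                                             *)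
Definition independent_processes d (Omega : measurableType d)
    (P : probability Omega R) (m : nat) (W : nat -> R -> Omega -> R) : Prop :=
  forall (q : nat) (s : nat -> R) (B : nat -> nat -> set R),
    (forall j, 0 <= s j) -> (forall i j, measurable (B i j)) ->
    P [set w | forall i j, (i < m)%N -> (j < q)%N -> B i j (W i (s j) w)] =
    (\prod_(i < m)
       P [set w | forall j, (j < q)%N -> B i j (W i (s j) w)])%E.

Definition same_fdd d d' (Omega : measurableType d) (Omega' : measurableType d')
    (P : probability Omega R) (P' : probability Omega' R) (m : nat)
    (Y : nat -> R -> Omega -> R) (Z : nat -> R -> Omega' -> R) : Prop :=
  forall (q : nat) (s : nat -> R) (B : nat -> nat -> set R),
    (forall j, 0 <= s j) -> (forall i j, measurable (B i j)) ->
    P [set w | forall i j, (i < m)%N -> (j < q)%N -> B i j (Y i (s j) w)] =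
    P' [set w | forall i j, (i < m)%N -> (j < q)%N -> B i j (Z i (s j) w)].

(* Coalescence of paths listed in increasing order of their start points: the
   path i.+1 follows W i.+1 until it meets the coalesced path i, and follows
   the latter from then on.                                                   *)
Fixpoint coalesce (W : nat -> R -> R) (i : nat) (s : R) : R :=
  match i with
  | 0 => W 0 s
  | i'.+1 =>
      if `[< exists r, [/\ 0 <= r, r <= s & W i r = coalesce W i' r] >]
      then coalesce W i' s else W i s
  end.

Definition coalescing_brownian_motions d (Omega : measurableType d)
    (P : probability Omega R) (u : seq R) (Y : nat -> R -> Omega -> R) : Prop :=
  exists d' (Omega' : measurableType d') (P' : probability Omega' R)
         (W : nat -> R -> Omega' -> R),
    [/\ forall i, (i < size u)%N -> brownian_motion P' (nth 0 u i) (W i),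
        independent_processes P' (size u) W &
        same_fdd P P' (size u) Y
          (fun i s w => coalesce (fun j r => W j r w) i s)].

(* X u s w is the position at time s of the particle started at u; only
   0 <= u <= 1 and s >= 0 matter. The monotone maps u |-> X u s w are taken
   right-continuous (their left limits exist by monotonicity): the
   finite-dimensional distributions do not exclude spurious values of X at
   random jump points u, which would change the image of X(., t).             *)
Record arratia_flow d (Omega : measurableType d) (P : probability Omega R)
    (X : R -> R -> Omega -> R) : Prop := {
  af_measurable : forall u s : R, 0 <= u <= 1 -> 0 <= s ->
    measurable_fun setT (X u s) ;
  af_nondecreasing : forall (u v s : R) w, 0 <= u -> u <= v -> v <= 1 -> 0 <= s ->
    X u s w <= X v s w ;
  af_right_continuous : forall (u s : R) w, 0 <= u < 1 -> 0 <= s ->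
    X v s w @[v --> u^'+] --> X u s w ;
  af_continuous : forall (u : R) w, 0 <= u <= 1 ->
    {within `[0, +oo[, continuous (fun s => X u s w)} ;
  af_coalescing : forall u : seq R, sorted <%R u ->
    {in u, forall x, 0 <= x <= 1} ->
    coalescing_brownian_motions P u (fun i => X (nth 0 u i))
}.

End BrownianMotion.

Section CoalescenceScheme.
Context (R : realType).
Implicit Types ys : seq (R -> R).

Local Notation path_at ys i := (nth (fun=> 0) ys i).

Definition in_collision ys (s : R) (i : nat) : Prop :=
  (i < size ys)%N /\
  exists j, [/\ (j < size ys)%N, j != i & path_at ys j s = path_at ys i s].

Definition collision_time ys : R :=
  inf [set s | 0 <= s /\ exists i, in_collision ys s i].

Definition collision_index ys : nat :=
  find (fun i => `[< in_collision ys (collision_time ys) i >])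
       (iota 0 (size ys)).

(* Indices in a scheme are numbered from 1, those in a sequence from 0.       *)
Fixpoint collision_scheme (r : nat) ys : seq nat :=
  match r with
  | 0 => [::]
  | r'.+1 => let j := collision_index ys in
      j.+1 :: collision_scheme r' (take j ys ++ drop j.+1 ys)
  end.

Definition coalescence_scheme (t : R) ys : seq nat :=
  collision_scheme (size ys - size (undup [seq y t | y <- ys])) ys.

(* The sequences (j_1, ..., j_r) with j_i in {1, ..., n - i}.                 *)
Fixpoint schemes (n r : nat) : seq (seq nat) :=
  match r with
  | 0 => [:: [::]]
  | r'.+1 => [seq j :: J | j <- iota 1 n.-1, J <- schemes n.-1 r']
  end.

End CoalescenceScheme.

Section Densities.
Context (R : realType) (k : nat).
Local Open Scope ereal_scope.

Definition distinct_tuples (S : set R) : set (k.-tuple R) :=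
  [set v : k.-tuple R | uniq v /\ forall i, S (tnth v i)].

Definition is_density (p : k.-tuple R -> R)
    (Phi : (k.-tuple R -> R) -> \bar R) : Prop :=
  measurable_fun setT p /\
  forall f : k.-tuple R -> R, measurable_fun setT f ->
    (forall y, (0 <= f y)%R) -> (exists M, forall y, (f y <= M)%R) ->
    \int[lebesgue_tuple R k]_y (f y * p y)%:E = Phi f.

Context d (Omega : measurableType d) (P : probability Omega R).
Variable X : R -> R -> Omega -> R.

Definition flow_image (t : R) (w : Omega) : set R :=
  [set X u t w | u in `[0%R, 1%R]].

Definition point_density (t : R) (p : k.-tuple R -> R) : Prop :=
  is_density p (fun f =>
    \int[P]_w \esum_(v in distinct_tuples (flow_image t w)) (f v)%:E).

Definition trajectories (x : seq R) (w : Omega) : seq (R -> R) :=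
  [seq (fun s => X u s w) | u <- x].

Definition scheme_point_density (t : R) (x : seq R) (J : seq nat)
    (p : k.-tuple R -> R) : Prop :=
  is_density p (fun f =>
    \int[P]_w (\esum_(v in distinct_tuples [set X u t w | u in [set` x]])
                  (f v)%:E *
               ((coalescence_scheme t (trajectories x w) == J)%:R)%:E)).

(* The density for n start points, from the densities pJ J of the schemes.    *)
Definition sum_schemes (n : nat) (pJ : seq nat -> k.-tuple R -> R)
    (y : k.-tuple R) : R :=
  (\sum_(k <= i < n.+1) \sum_(J <- schemes n (n - i)) pJ J y)%R.

End Densities.

(* Main.v *)
(** Every tuple of distinct points of [{X(u, t) : u in U_n}] is counted under
    exactly one coalescence scheme, so the sum over schemes has, against an
    indicator, the integral [E #{distinct tuples of {X(u, t) : u in U_n} in A}].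
    These expectations increase with [n] since the [U_n] are nested, and
    densities are ordered almost everywhere when their integrals over all sets
    are. The limit is the expectation for the whole flow because almost surely
    [X_t = {X(u, t) : u in U_n}] for all large [n]: by the reflection principle
    the particles started at [u < v] are still apart at time [t] with
    probability [O(v - u)], hence the expected cardinality of
    [{X(u, t) : u in U_n}] is bounded, these increasing finite sets stabilise,
    and right-continuity in [u] leaves no further values in the image. *)

Require Import Defs.
From mathcomp Require Import all_boot all_order all_algebra.
From mathcomp Require Import all_classical all_reals all_analysis.
From mathcomp Require Import measurable_realfun.
From mathcomp Require Import ring lra zify.
Set Implicit Arguments.
Unset Strict Implicit.
Unset Printing Implicit Defensive.
Import Order.TTheory GRing.Theory Num.Theory.
Import numFieldNormedType.Exports.
Local Open Scope classical_set_scope.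
Local Open Scope ring_scope.

(** * Independence *)

(** [arratia_flow] gives only finite-dimensional distributions and [brownian_motion] only
    independent Gaussian increments, so reflecting at a random hitting time would first require a
    strong Markov property. The bound O(v - u) is instead proved for the gap of two paths sampled at
    mesh t / n, where conditioning on the past is plain Fubini. A sampled walk jumps over 0 instead
    of hitting it; the reflection is therefore made about the level - eps, and it can fail only
    through a step below - eps. A step of variance h has such a tail of order h^2 for fixed eps, so
    the n steps together cost O(1 / n); afterwards eps tends to 0. On the side of densities, no sign
    is imposed on them, and the sum over the whole image of the flow is not known to be measurable
    in [w]. Signs are recovered almost everywhere from integrals against indicators, and the
    expectation for the whole flow is compared with measurable ones only by inequalities. *)

Section Independence.
Local Open Scope ereal_scope.
Context {d} {Omega : measurableType d} {R : realType} (P : probability Omega R).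

Definition independent_maps {d1 d2} {T1 : measurableType d1}
    {T2 : measurableType d2} (f : Omega -> T1) (g : Omega -> T2) : Prop :=
  forall A B, measurable A -> measurable B ->
    P (f @^-1` A `&` g @^-1` B) = P (f @^-1` A) * P (g @^-1` B).

Lemma preimage_meas {d1 d2} {T1 : measurableType d1} {T2 : measurableType d2}
    (f : T1 -> T2) A :
  measurable_fun setT f -> measurable A -> measurable (f @^-1` A).
Proof. by move=> mf mA; rewrite -[X in measurable X]setTI; exact: mf. Qed.

Lemma law_restr {d1} {T1 : measurableType d1} (f : Omega -> T1)
    (E : set Omega) : measurable_fun setT f -> measurable E ->
  exists m : {measure set T1 -> \bar R},
    forall A, m A = P (f @^-1` A `&` E).
Proof.
move=> mf mE.
unshelve eexists [the {measure set T1 -> \bar R} of pushforward (mrestr P mE) f].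
  exact: mf.
by move=> A.
Qed.

Lemma law_exists {d1} {T1 : measurableType d1} (f : Omega -> T1) :
  measurable_fun setT f ->
  exists m : probability T1 R, forall A, m A = P (f @^-1` A).
Proof.
move=> mf.
pose F : {mfun Omega >-> T1} := mfun_Sub (mem_set mf).
by exists (distribution P F).
Qed.

Lemma measure_unique_setT {d1} {T1 : measurableType d1} (G : set (set T1))
    (m1 m2 : {measure set T1 -> \bar R}) :
  measurable = <<s G >> -> setI_closed G -> G setT ->
  (forall A, G A -> m1 A = m2 A) -> m1 setT < +oo ->
  forall A, measurable A -> m1 A = m2 A.
Proof.
move=> mG GI GT m12 m1oo; apply: (measure_unique G (fun=> setT)) => //.
by rewrite bigcup_const//; exists 0%N.
Qed.

(** Both sides are finite measures in [A]: the law of [f] restricted to [E], and the law of [f]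
    scaled by the constant [P E]. Agreement on a generating pi-system therefore extends to all
    measurable sets. *)
Lemma independent_event_pi {d1} {T1 : measurableType d1}
    (G : set (set T1)) (f : Omega -> T1) (E : set Omega) :
  measurable_fun setT f -> measurable E ->
  measurable = <<s G >> -> setI_closed G -> G setT ->
  (forall A, G A -> P (f @^-1` A `&` E) = P (f @^-1` A) * P E) ->
  forall A, measurable A -> P (f @^-1` A `&` E) = P (f @^-1` A) * P E.
Proof.
move=> mf mE mG GI GT fE A mA.
have [m1 m1E] := law_restr mf mE.
have [m2 m2E] := law_restr mf measurableT.
have PE : P E \is a fin_num by exact: fin_num_measure.
pose c : {nonneg R} := NngNum (fine_ge0 (measure_ge0 P E)).
have m2cE A' : mscale c m2 A' = P (f @^-1` A') * P E.
  by rewrite /mscale/= m2E setIT fineK// muleC.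
rewrite -m1E -m2cE; apply: (measure_unique_setT (G := G)) => //.
- by move=> A' GA; rewrite [LHS]m1E [RHS]m2cE; exact: fE.
- by rewrite m1E preimage_setT setTI ltey_eq PE.
Qed.

Lemma independent_pi {d1 d2} {T1 : measurableType d1} {T2 : measurableType d2}
    (G : set (set T1)) (H : set (set T2)) (f : Omega -> T1) (g : Omega -> T2) :
  measurable_fun setT f -> measurable_fun setT g ->
  measurable = <<s G >> -> setI_closed G -> G setT ->
  measurable = <<s H >> -> setI_closed H -> H setT ->
  (forall A B, G A -> H B ->
    P (f @^-1` A `&` g @^-1` B) = P (f @^-1` A) * P (g @^-1` B)) ->
  independent_maps f g.
Proof.
move=> mf mg mG GI GT mH HI HT fg A B mA mB.
apply: (independent_event_pi (G := G)) => //; first exact: preimage_meas.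
move=> A' GA; rewrite setIC muleC; apply: (independent_event_pi (G := H)) => //.
  by apply: preimage_meas => //; rewrite mG; exact: sub_sigma_algebra.
by move=> B' HB; rewrite setIC muleC fg.
Qed.

Lemma independent_mapsC {d1 d2} {T1 : measurableType d1}
    {T2 : measurableType d2} (f : Omega -> T1) (g : Omega -> T2) :
  independent_maps f g -> independent_maps g f.
Proof. by move=> fg A B mA mB; rewrite setIC fg// muleC. Qed.

Lemma independent_comp {d1 d2 d3 d4} {T1 : measurableType d1}
    {T2 : measurableType d2} {T3 : measurableType d3} {T4 : measurableType d4}
    (f : Omega -> T1) (g : Omega -> T2) (u : T1 -> T3) (v : T2 -> T4) :
  measurable_fun setT u -> measurable_fun setT v ->
  independent_maps f g -> independent_maps (u \o f) (v \o g).
Proof.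
move=> mu mv fg A B mA mB.
exact: (fg _ _ (preimage_meas mu mA) (preimage_meas mv mB)).
Qed.

Definition rectangles {d1 d2} (T1 : measurableType d1) (T2 : measurableType d2)
  : set (set (T1 * T2)) :=
  [set A `*` B | A in measurable & B in measurable].
Arguments rectangles {d1 d2} T1 T2 _.

Lemma rectanglesI {d1 d2} (T1 : measurableType d1) (T2 : measurableType d2) :
  setI_closed (rectangles T1 T2).
Proof.
move=> _ _ [A mA [B mB <-]] [A' mA' [B' mB' <-]].
exists (A `&` A'); first exact: measurableI.
exists (B `&` B'); first exact: measurableI.
by rewrite setXI.
Qed.

Lemma rectanglesT {d1 d2} (T1 : measurableType d1) (T2 : measurableType d2) :
  rectangles T1 T2 setT.
Proof. by exists setT => //; exists setT => //; rewrite setXTT. Qed.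

(** The three independences make the four maps mutually independent, after which they can be
    regrouped. This separates the joint past of two independent walks from their joint next step. *)
Lemma independent_regroup {d1 d2 d3 d4} {T1 : measurableType d1}
    {T2 : measurableType d2} {T3 : measurableType d3} {T4 : measurableType d4}
    (f : Omega -> T1) (u : Omega -> T2) (g : Omega -> T3) (v : Omega -> T4) :
  measurable_fun setT f -> measurable_fun setT u ->
  measurable_fun setT g -> measurable_fun setT v ->
  independent_maps f u -> independent_maps g v ->
  independent_maps (fun w => (f w, u w)) (fun w => (g w, v w)) ->
  independent_maps (fun w => (f w, g w)) (fun w => (u w, v w)).
Proof.
move=> mf mu mg mv fu gv H.
have mfg : measurable_fun setT (fun w => (f w, g w)) by exact/measurable_fun_pair.
have muv : measurable_fun setT (fun w => (u w, v w)) by exact/measurable_fun_pair.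
have fg A B : measurable A -> measurable B ->
    P (f @^-1` A `&` g @^-1` B) = P (f @^-1` A) * P (g @^-1` B).
  exact: (independent_comp measurable_fst measurable_fst H).
have uv A B : measurable A -> measurable B ->
    P (u @^-1` A `&` v @^-1` B) = P (u @^-1` A) * P (v @^-1` B).
  exact: (independent_comp measurable_snd measurable_snd H).
have rect A A' B B' : measurable A -> measurable A' -> measurable B ->
    measurable B' ->
    P ((f @^-1` A `&` g @^-1` A') `&` (u @^-1` B `&` v @^-1` B')) =
    P (f @^-1` A `&` g @^-1` A') * P (u @^-1` B `&` v @^-1` B').
  move=> mA mA' mB mB'.
  have := H (A `*` B) (A' `*` B') (measurableX mA mB) (measurableX mA' mB').
  have := fu _ _ mA mB; have := gv _ _ mA' mB'.
  rewrite fg// uv//.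
  rewrite (_ : _ @^-1` (A `*` B) = f @^-1` A `&` u @^-1` B)//.
  rewrite (_ : _ @^-1` (A' `*` B') = g @^-1` A' `&` v @^-1` B')//.
  move=> -> -> E.
  by rewrite setIACA E muleACA.
apply: (independent_pi (G := rectangles T1 T3) (H := rectangles T2 T4)) => //.
- exact: measurable_prod_measurableType.
- exact: rectanglesI.
- exact: rectanglesT.
- exact: measurable_prod_measurableType.
- exact: rectanglesI.
- exact: rectanglesT.
by move=> _ _ [A mA [A' mA' <-]] [B mB [B' mB' <-]]; exact: rect.
Qed.

(** The joint law is the product of the law of [f] and [nu], so Tonelli integrates [g] out first.
    This plays the part of conditioning on the past. *)
Lemma integral_independent {d1 d2} {T1 : measurableType d1}
    {T2 : measurableType d2} (f : Omega -> T1) (g : Omega -> T2)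
    (nu : probability T2 R) (phi : T1 * T2 -> \bar R) :
  measurable_fun setT f -> measurable_fun setT g -> independent_maps f g ->
  (forall B, measurable B -> P (g @^-1` B) = nu B) ->
  measurable_fun [set: T1 * T2] phi -> (forall x, 0 <= phi x) ->
  \int[P]_w phi (f w, g w) = \int[P]_w \int[nu]_y phi (f w, y).
Proof.
move=> mf mg fg gnu mphi phi0.
have mfg : measurable_fun setT (fun w => (f w, g w)) by exact/measurable_fun_pair.
have [m1 m1E] := law_exists mf.
have [m mE] := law_exists mfg.
have mphi' : measurable_fun setT (phi \o (fun w => (f w, g w))).
  exact: measurableT_comp.
transitivity (\int[m]_z phi z).
  rewrite (eq_measure_integral (pushforward P (fun w => (f w, g w)))); last first.
    by move=> A mA _; exact: mE.
  by rewrite ge0_integral_pushforward.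
transitivity (\int[(m1 \x nu)%E]_z phi z).
  apply: eq_measure_integral => A mA _.
  apply/esym; apply: product_measure_unique => // B C mB mC /=.
  by rewrite mE m1E -gnu// -fg.
rewrite fubini_tonelli1// (eq_measure_integral (pushforward P f)); last first.
  by move=> A mA _; exact: m1E.
rewrite ge0_integral_pushforward//.
- exact: measurable_fun_fubini_tonelli_F.
- by move=> x _; exact: integral_ge0.
Qed.

End Independence.
Arguments rectangles {d1 d2} T1 T2 _.

Section ComparisonSets.
Context {d} {T : measurableType d} {R : realType}.
Implicit Types f g : T -> R.

Lemma measurable_lt_set f g : measurable_fun setT f -> measurable_fun setT g ->
  measurable [set x | f x < g x].
Proof.
move=> mf mg; rewrite (_ : mkset _ = (fun x => f x < g x) @^-1` [set true]).
  by apply: preimage_meas => //; exact: measurable_fun_ltr.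
by apply/seteqP; split.
Qed.

Lemma measurable_eq_set f g : measurable_fun setT f -> measurable_fun setT g ->
  measurable [set x | f x = g x].
Proof.
move=> mf mg; rewrite (_ : mkset _ = ~` ([set x | f x < g x] `|` [set x | g x < f x])).
  by apply: measurableC; apply: measurableU; exact: measurable_lt_set.
apply/seteqP; split=> x /=; first by move=> ->; rewrite ltxx => -[].
by move=> /not_orP[/negP fg /negP gf]; apply/le_anti; rewrite !leNgt fg gf.
Qed.

End ComparisonSets.

(** * Cylinder sets as a generating pi-system of the tuple sigma-algebra *)

Section Boxes.
Context {R : realType}.

(** The sides are indexed by [nat], as in [independent_processes] and [bm_independent_increments],
    so that those product rules apply to boxes directly. *)
Definition boxes (n : nat) : set (set (n.-tuple R)) :=
  [set [set v : n.-tuple R | forall i : 'I_n, B i (tnth v i)]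
    | B in [set B : nat -> set R | forall j, measurable (B j)]].
Arguments boxes n _ : clear implicits.

Lemma boxesI n : setI_closed (boxes n).
Proof.
move=> _ _ [B mB <-] [C mC <-]; exists (fun j => B j `&` C j).
  by move=> j; exact: measurableI.
apply/seteqP; split=> v /= => [BC|[Bv Cv] i]; last by split.
by split=> i; have [] := BC i.
Qed.

Lemma boxesT n : boxes n setT.
Proof. by exists (fun=> setT) => //; apply/seteqP; split. Qed.

Lemma measurable_boxes n : @measurable _ (n.-tuple R) = <<s boxes n >>.
Proof.
apply/seteqP; split.
  apply: smallest_sub; first exact: smallest_sigma_algebra.
  move=> A; rewrite -bigcup_seq/= => -[i _ [B mB <-]].
  apply: sub_sigma_algebra.
  exists (fun j => if j == i :> nat then B else setT).
    by move=> j; case: ifP.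
  rewrite setTI; apply/seteqP; split=> v /=.
    by move=> /(_ i); rewrite eqxx.
  by move=> Bv j; case: ifPn => // /eqP/val_inj ->.
apply: smallest_sub; first exact: sigma_algebra_measurable.
move=> _ [B mB <-].
rewrite (_ : mkset _ = \bigcap_(i in [set: 'I_n]) (@tnth n R ^~ i) @^-1` (B i)).
  apply: fin_bigcap_measurable => // i _.
  by apply: preimage_meas => //; exact: measurable_tnth.
by apply/seteqP; split=> v /= H i => [_|]; exact: H.
Qed.

End Boxes.
Arguments boxes {R} n _.

(** * The meeting probability of two Brownian motions *)

Section NormalEstimates.
Context {R : realType}.
Implicit Types s c a b x y : R.

(** Square exp (y / 2) >= y / 2. The second-order decay is what makes n tails of variance t / n add
    up to O(1 / n). *)
Lemma expRN_le y : (0 < y) -> (expR (- y) <= 4 / y ^+ 2).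
Proof.
move=> y0; rewrite expRN -(invrK (4 / y ^+ 2)) lef_pV2 ?posrE ?expR_gt0//; last first.
  by rewrite invr_gt0 divr_gt0// exprn_gt0.
have -> : (4 / y ^+ 2)^-1 = (y / 2) ^+ 2 by field; rewrite gt_eqF.
have -> : expR y = expR (y / 2) ^+ 2 by rewrite -expRM_natl -mulr_natl; congr expR; field.
apply: lerXn2r.
- by rewrite nnegrE divr_ge0// ltW.
- by rewrite nnegrE expR_ge0.
by apply: le_trans (expR_ge1Dx (y / 2)); lra.
Qed.

Local Open Scope ereal_scope.

Lemma normal_prob_itv_le s a b : (s != 0)%R -> (a <= b)%R ->
  normal_prob 0 s `[a, b[ <= ((b - a) * normal_peak s)%:E.
Proof.
move=> s0 ab; rewrite /normal_prob.
apply: (@le_trans _ _ (\int[lebesgue_measure]_(x in `[a, b[) (normal_peak s)%:E)).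
  apply: ge0_le_integral => //=.
  - by move=> x _; rewrite lee_fin normal_pdf_ge0.
  - apply/measurable_EFinP; apply: measurable_funTS; exact: measurable_normal_pdf.
  - by move=> x _; rewrite lee_fin normal_pdf_ub.
rewrite integral_cst//= lebesgue_measure_itv/= lte_fin.
move: ab; rewrite le_eqVlt => /orP[/eqP ->|ab].
  by rewrite ltxx mule0 subrr mul0r.
by rewrite ab -EFinD -EFinM mulrC.
Qed.

(* For [c <= |x|] the density at [x] is at most
   [sqrt 2 * exp (- c^2 / (4 s^2))] times the centered normal density of
   variance [2 s^2]. *)
Lemma normal_prob_tail s c : (0 < s)%R -> (0 < c)%R ->
  normal_prob 0 s [set x | (c <= `|x|)%R] <=
  (2 * (4 / (c ^+ 2 / (4 * s ^+ 2)) ^+ 2))%:E.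
Proof.
move=> s0 c0; rewrite /normal_prob.
pose s2 := (Num.sqrt 2 * s)%R.
have s20 : (0 < s2)%R by rewrite mulr_gt0// sqrtr_gt0.
have s2E : (s2 ^+ 2 = 2 * s ^+ 2)%R by rewrite exprMn sqr_sqrtr.
(* The factor 2 rounds up the ratio sqrt 2 of the two peaks. *)
pose e := (2 * expR (- (c ^+ 2 / (4 * s ^+ 2))))%R.
have e0 : (0 <= e)%R by rewrite mulr_ge0// expR_ge0.
have mE : measurable [set x : R | (c <= `|x|)%R].
  rewrite (_ : mkset _ = (fun x : R => `|x|%R) @^-1` `[c, +oo[); last first.
    by apply/seteqP; split => x /=; rewrite in_itv/= andbT.
  by apply: preimage_meas => //; exact: normr_measurable.
apply: (@le_trans _ _ (\int[lebesgue_measure]_(x in [set: R])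
   (e%:E * (normal_pdf 0 s2 x)%:E))); last first.
  rewrite ge0_integralZl//=.
  - rewrite integral_normal_pdf mule1 lee_fin ler_pM2l// expRN_le//.
    by rewrite divr_gt0 ?exprn_gt0// mulr_gt0// exprn_gt0.
  - by apply/measurable_EFinP; exact: measurable_normal_pdf.
  - by move=> x _; rewrite lee_fin normal_pdf_ge0.
apply: (@le_trans _ _ (\int[lebesgue_measure]_(x in [set x : R | (c <= `|x|)%R])
   (e%:E * (normal_pdf 0 s2 x)%:E))); last first.
  apply: ge0_subset_integral => //.
  - apply: emeasurable_funM => //.
    by apply/measurable_EFinP; exact: measurable_normal_pdf.
  - by move=> x _; rewrite mule_ge0// lee_fin ?normal_pdf_ge0.
apply: ge0_le_integral => //=.
- by move=> x _; rewrite lee_fin normal_pdf_ge0.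
- apply/measurable_EFinP; apply: measurable_funTS; exact: measurable_normal_pdf.
- apply: emeasurable_funM => //; apply/measurable_EFinP.
  by apply: measurable_funTS; exact: measurable_normal_pdf.
move=> x cx; rewrite -EFinM lee_fin !normal_pdfE ?gt_eqF//=.
rewrite /normal_fun !subr0.
have -> : (normal_peak s = Num.sqrt 2 * normal_peak s2)%R.
  have -> : normal_peak s2 = (Num.sqrt 2 * Num.sqrt (s ^+ 2 * pi *+ 2))^-1%R.
    by rewrite /normal_peak s2E -sqrtrM// -!mulrnAr !mulrA.
  by rewrite invfM mulrA divff ?mul1r// gt_eqF// sqrtr_gt0.
rewrite /e -mulrA mulrCA [leRHS]mulrCA -[in leRHS]mulrA ler_pM2l ?normal_peak_gt0 ?gt_eqF//.
apply: ler_pM; rewrite ?sqrtr_ge0 ?expR_ge0//.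
  by rewrite -[leRHS]ger0_norm// -sqrtr_sqr ler_sqrt// expr2; lra.
rewrite -expRD ler_expR s2E.
have cx2 : (c ^+ 2 <= x ^+ 2)%R.
  by rewrite -[leRHS]real_normK ?num_real// lerXn2r// ?nnegrE// ltW.
rewrite -subr_ge0.
rewrite [leRHS](_ : _ = (x ^+ 2 - c ^+ 2) / (4 * s ^+ 2))%R; last first.
  by field; rewrite gt_eqF.
by rewrite divr_ge0 ?subr_ge0// mulr_ge0// sqr_ge0.
Qed.

(** For a fixed first coordinate the event is a translate of [[a, b[], whose length and hence bound
    do not depend on the translation. No convolution is computed; the price is the peak of one
    coordinate instead of that of the difference. *)
Lemma normal_difference_itv_le (N : probability R R) s a b :
  (forall A, measurable A -> N A = normal_prob 0 s A) -> (s != 0)%R -> (a <= b)%R ->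
  (N \x N)%E
    ((fun z : R * R => z.2 - z.1)%R @^-1` `[a, b[) <=
  ((b - a) * normal_peak s)%:E.
Proof.
move=> NE s0 ab.
have msub : measurable_fun [set: R * R] (fun z : R * R => z.2 - z.1)%R.
  exact: measurable_funB.
have mA : measurable ((fun z : R * R => z.2 - z.1)%R @^-1` `[a, b[).
  exact: preimage_meas.
rewrite /product_measure1.
apply: (@le_trans _ _ (\int[N]_(x in [set: R])
   ((b - a) * normal_peak s)%:E)); last first.
  by rewrite integral_cst//= probability_setT mule1.
apply: ge0_le_integral => //=.
- exact: measurable_fun_xsection.
move=> x _; rewrite /xsection/=.
rewrite (_ : mkset _ = `[(a + x)%R, (b + x)%R[%classic).
  have -> : (b - a = (b + x) - (a + x))%R by ring.
  by rewrite NE//; apply: normal_prob_itv_le => //; rewrite lerD2r.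
apply/seteqP; split=> y /=; rewrite inE/= !in_itv/= => /andP[h1 h2]; apply/andP; split; lra.
Qed.

(** A difference below - c forces one of the coordinates to have modulus at least c / 2. *)
Lemma normal_difference_tail (N : probability R R) s c :
  (forall A, measurable A -> N A = normal_prob 0 s A) -> (0 < s)%R -> (0 < c)%R ->
  (N \x N)%E
    ((fun z : R * R => z.2 - z.1)%R @^-1` `]-oo, (- c)%R[) <=
  (4 * (4 / ((c / 2) ^+ 2 / (4 * s ^+ 2)) ^+ 2))%:E.
Proof.
move=> NE s0 c0.
pose T := [set x : R | (c / 2 <= `|x|)%R].
have mT : measurable T.
  rewrite (_ : T = (fun x : R => `|x|%R) @^-1` `[c / 2, +oo[)%R; last first.
    by apply/seteqP; split => x /=; rewrite in_itv/= andbT.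
  by apply: preimage_meas => //; exact: normr_measurable.
have msub : measurable_fun [set: R * R] (fun z : R * R => z.2 - z.1)%R.
  exact: measurable_funB.
apply: (@le_trans _ _ ((N \x N)%E
    (T `*` setT `|` setT `*` T))).
  apply: le_measure; rewrite ?inE//.
  - exact: preimage_meas.
  - by apply: measurableU; exact: measurableX.
  move=> [x y] /=; rewrite in_itv/= /T => xy.
  case: (lerP (c / 2) `|x|)%R => hx; first by left.
  right; split => //=; rewrite leNgt; apply/negP => hy.
  by move: hx hy; rewrite !ltr_norml => /andP[? ?] /andP[? ?]; lra.
have -> : (4 * (4 / ((c / 2) ^+ 2 / (4 * s ^+ 2)) ^+ 2) =
  (2 * (4 / ((c / 2) ^+ 2 / (4 * s ^+ 2)) ^+ 2)) +
  (2 * (4 / ((c / 2) ^+ 2 / (4 * s ^+ 2)) ^+ 2)))%R by lra.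
have c2 : (0 < c / 2)%R by rewrite divr_gt0.
have E1 : (N \x N)%E (T `*` setT) = N T.
  by rewrite product_measure1E//= probability_setT mule1.
have E2 : (N \x N)%E (setT `*` T) = N T.
  by rewrite product_measure1E//= probability_setT mul1e.
apply: le_trans (measureU2 _ _ _) _; try exact: measurableX.
rewrite EFinD; apply: leeD.
  by rewrite [leLHS]E1 NE//; exact: normal_prob_tail.
by rewrite [leLHS]E2 NE//; exact: normal_prob_tail.
Qed.

End NormalEstimates.

(** * Reflection for the gap of two sampled Brownian paths *)

Section RandomWalk.
Local Open Scope ereal_scope.
Context {R : realType} {d} {Omega : measurableType d} (P : probability Omega R).
Context (x : nat -> R) (W : nat -> R -> Omega -> R) (h : R).
Hypothesis h_gt0 : (0 < h)%R.
Hypothesis W_bm : forall i, (i < 2)%N -> brownian_motion P (x i) (W i).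
Hypothesis W_indep : independent_processes P 2 W.

Let s (j : nat) : R := (j%:R * h)%R.

Let s_ge0 j : (0 <= s j)%R.
Proof. by rewrite mulr_ge0// ltW. Qed.

Let sS j : (s j.+1 - s j = h)%R.
Proof. by rewrite /s -mulrBl -natrB// subSnn mul1r. Qed.

Let s_lt j : (s j < s j.+1)%R.
Proof. by rewrite -subr_gt0 sS. Qed.

Definition walk_values i m w : m.-tuple R := [tuple W i (s j) w | j < m].

Definition walk_step i j w : R := (W i (s j.+1) w - W i (s j) w)%R.

Definition walk_steps i m w : m.-tuple R := [tuple walk_step i j w | j < m].

Let mW i j : (i < 2)%N -> measurable_fun setT (W i (s j)).
Proof. by move=> i2; exact: bm_measurable (W_bm i2) _ (s_ge0 j). Qed.

Let measurable_walk_values i m : (i < 2)%N ->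
  measurable_fun setT (walk_values i m).
Proof.
move=> i2; apply/measurable_fun_tnthP => j.
rewrite (_ : _ \o _ = W i (s j)); first exact: mW.
by apply/funext => w /=; rewrite tnth_mktuple.
Qed.

Let measurable_walk_step i j : (i < 2)%N -> measurable_fun setT (walk_step i j).
Proof. by move=> i2; apply: measurable_funB; exact: mW. Qed.

Let measurable_walk_steps i m : (i < 2)%N ->
  measurable_fun setT (walk_steps i m).
Proof.
move=> i2; apply/measurable_fun_tnthP => j.
rewrite (_ : _ \o _ = walk_step i j); first exact: measurable_walk_step.
by apply/funext => w /=; rewrite tnth_mktuple.
Qed.

Let independent_values m : independent_maps P (walk_values 0 m) (walk_values 1 m).
Proof.
apply: (independent_pi (G := boxes m) (H := boxes m)).
- exact: measurable_walk_values.
- exact: measurable_walk_values.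
- exact: measurable_boxes.
- exact: boxesI.
- exact: boxesT.
- exact: measurable_boxes.
- exact: boxesI.
- exact: boxesT.
move=> _ _ [B mB <-] [C mC <-].
have mBC i j : measurable ((if i == 0%N then B else C) j) by case: ifP.
have := W_indep (B := fun i => if i == 0%N then B else C) m s_ge0 mBC.
rewrite !big_ord_recl big_ord0 mule1/=.
rewrite [X in P X = _ -> _](_ : _ = walk_values 0 m @^-1` [set v : m.-tuple R | forall i : 'I_m, B i (tnth v i)]
  `&` walk_values 1 m @^-1` [set v : m.-tuple R | forall i : 'I_m, C i (tnth v i)]); last first.
  apply/seteqP; split=> w /= H.
    split=> i; rewrite tnth_mktuple; first exact: (H 0%N).
    exact: (H 1%N).
  move=> [|[|//]] j _ jm.
    by have := H.1 (Ordinal jm); rewrite tnth_mktuple.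
  by have := H.2 (Ordinal jm); rewrite tnth_mktuple.
move=> ->; congr (P _ * P _); apply/seteqP; split=> w /= H.
- by move=> i; rewrite tnth_mktuple; exact: H.
- by move=> j jm; have := H (Ordinal jm); rewrite tnth_mktuple.
- by move=> i; rewrite tnth_mktuple; exact: H.
- by move=> j jm; have := H (Ordinal jm); rewrite tnth_mktuple.
Qed.

Let independent_steps i m : (i < 2)%N ->
  independent_maps P (walk_steps i m) (walk_step i m).
Proof.
move=> i2 A C mA mC.
have mC' := preimage_meas (measurable_walk_step m i2) mC.
apply: (independent_event_pi (G := boxes m)) => //.
- exact: measurable_walk_steps.
- exact: measurable_boxes.
- exact: boxesI.
- exact: boxesT.
move=> _ [B mB <-].
have s0 : (0 <= s 0%N)%R by [].
have s_le j : (s j <= s j.+1)%R by exact/ltW.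
(* [D] lists the sides of the box and then [C] at place [m]: the product rules for [m.+1] and for
   [m] increments differ by the factor of [walk_step i m]. *)
pose D j := if (j < m)%N then B j else C.
have mD j : measurable (D j) by rewrite /D; case: ifP.
have E1 := bm_independent_increments (W_bm i2) (q := m.+1) s0 (fun j _ => s_le j) mD.
have E2 := bm_independent_increments (W_bm i2) (q := m) s0 (fun j _ => s_le j) mD.
have -> : walk_steps i m @^-1` [set v : m.-tuple R | forall j : 'I_m, B j (tnth v j)] =
    [set w | forall j, (j < m)%N -> D j (W i (s j.+1) w - W i (s j) w)%R].
  apply/seteqP; split=> w /= H.
    by move=> j jm; have := H (Ordinal jm); rewrite tnth_mktuple/= /D jm.
  by move=> j; have := H j (ltn_ord j); rewrite tnth_mktuple/= /D ltn_ord.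
have -> : [set w | forall j, (j < m)%N -> D j (W i (s j.+1) w - W i (s j) w)%R]
    `&` walk_step i m @^-1` C =
    [set w | forall j, (j < m.+1)%N -> D j (W i (s j.+1) w - W i (s j) w)%R].
  apply/seteqP; split=> w /=.
    move=> [H1 H2] j; rewrite ltnS leq_eqVlt => /orP[/eqP ->|]; last exact: H1.
    by rewrite /D ltnn.
  move=> H; split=> [j jm|]; first by apply: H; exact: ltnW.
  by have := H m (ltnSn m); rewrite /D ltnn.
rewrite E1 E2 big_ord_recr/=; congr (_ * P _).
by apply/seteqP; split=> w /=; rewrite /D ltnn.
Qed.

(** Within each walk the next step is independent of the past ones. The two walks are independent
    because their first m + 1 steps are functions of the positions at m + 2 sampling times.
    [independent_regroup] then exchanges the grouping. *)
Let independent_past m : independent_maps P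
  (fun w => (walk_steps 0 m w, walk_steps 1 m w))
  (fun w => (walk_step 0 m w, walk_step 1 m w)).
Proof.
apply: independent_regroup.
- exact: measurable_walk_steps.
- exact: measurable_walk_step.
- exact: measurable_walk_steps.
- exact: measurable_walk_step.
- exact: independent_steps.
- exact: independent_steps.
pose step (v : m.+2.-tuple R) j : R := (tnth v (inord j.+1) - tnth v (inord j))%R.
pose u (v : m.+2.-tuple R) := ([tuple step v j | j < m], step v m).
have mstep j : measurable_fun setT (step ^~ j).
  by apply: measurable_funB; exact: measurable_tnth.
have mu : measurable_fun setT u.
  apply/measurable_fun_pair => //; apply/measurable_fun_tnthP => j.
  rewrite (_ : _ \o _ = step ^~ j)//.
  by apply/funext => v /=; rewrite tnth_mktuple.
have E i : (fun w => (walk_steps i m w, walk_step i m w)) = u \o walk_values i m.+2.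
  have stepE j w : (j < m.+1)%N -> step (walk_values i m.+2 w) j = walk_step i j w.
    by move=> jm; rewrite /step !tnth_mktuple !inordK// ltnS// ltnW.
  apply/funext => w; rewrite /u/=; congr (_, _); last by rewrite stepE.
  by apply: eq_from_tnth => j; rewrite !tnth_mktuple stepE// ltnW// ltnS.
rewrite !E; exact: independent_comp.
Qed.

Variable N : probability R R.
Hypothesis NE : forall A, measurable A -> N A = normal_prob 0 (Num.sqrt h) A.

Let step_law i j A : (i < 2)%N -> measurable A ->
  P (walk_step i j @^-1` A) = N A.
Proof.
move=> i2 mA; rewrite NE// -(sS j).
exact: (bm_normal (W_bm i2) (s_ge0 j) (s_lt j) mA).
Qed.

Let gamma2 := (N \x N)%E.

Let steps_law j A : measurable A ->
  P ((fun w => (walk_step 0 j w, walk_step 1 j w)) @^-1` A) = gamma2 A.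
Proof.
move=> mA.
have m2 : measurable_fun setT (fun w => (walk_step 0 j w, walk_step 1 j w)).
  by apply/measurable_fun_pair => //; exact: measurable_walk_step.
have [m mE] := law_exists P m2.
rewrite -mE /gamma2; apply/esym; apply: (product_measure_unique (m1 := N) (m2 := N)) => // B C mB mC.
rewrite [LHS]mE.
transitivity (P (walk_step 0 j @^-1` B) * P (walk_step 1 j @^-1` C)); last first.
  by congr (_ * _); exact: step_law.
have H := @independent_values j.+2.
pose u (v : j.+2.-tuple R) : R := (tnth v (inord j.+1) - tnth v (inord j))%R.
have mu : measurable_fun setT u.
  by apply: measurable_funB; exact: measurable_tnth.
have E i : walk_step i j = u \o walk_values i j.+2.
  by apply/funext => w; rewrite /u/= !tnth_mktuple !inordK// ltnS.
rewrite !E; exact: (independent_comp mu mu H).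
Qed.

(** [gamma2] is invariant under exchange of the coordinates, so a gap step and its opposite have the
    same law: the symmetry on which the reflection rests. *)
Let steps_law_swap j A : measurable A ->
  P ((fun w => (walk_step 1 j w, walk_step 0 j w)) @^-1` A) = gamma2 A.
Proof.
move=> mA.
have m2 : measurable_fun setT (fun w => (walk_step 1 j w, walk_step 0 j w)).
  by apply/measurable_fun_pair => //; exact: measurable_walk_step.
have [m mE] := law_exists P m2.
rewrite -mE /gamma2; apply/esym; apply: (product_measure_unique (m1 := N) (m2 := N)) => // B C mB mC.
rewrite [LHS]mE; transitivity (gamma2 (C `*` B)); last first.
  by rewrite /gamma2 product_measure1E//= muleC.
rewrite -(steps_law j); last exact: measurableX.
by congr (P _); apply/seteqP; split=> w /= -[].
Qed.

Definition gap_step j w : R := (walk_step 1 j w - walk_step 0 j w)%R.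

Let msub : measurable_fun [set: R * R] (fun z : R * R => z.2 - z.1)%R.
Proof. exact: measurable_funB. Qed.

Let measurable_gap_step j : measurable_fun setT (gap_step j).
Proof. by apply: measurable_funB; exact: measurable_walk_step. Qed.

Lemma gap_step_law j A : measurable A ->
  P (gap_step j @^-1` A) = gamma2 ((fun z : R * R => z.2 - z.1)%R @^-1` A).
Proof. by move=> mA; rewrite -(steps_law j)//; exact: preimage_meas. Qed.

Let gap_step_law_opp j A : measurable A ->
  P ((fun w => - gap_step j w)%R @^-1` A) = gamma2 ((fun z : R * R => z.2 - z.1)%R @^-1` A).
Proof.
move=> mA; rewrite -(steps_law_swap j); last exact: preimage_meas.
suff -> : (fun w => - gap_step j w)%R =
    (fun z => z.2 - z.1)%R \o (fun w => (walk_step 1 j w, walk_step 0 j w)) by [].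
by apply/funext => w /=; rewrite /gap_step opprB.
Qed.

Let delta := (x 1%N - x 0%N)%R.

Definition gap j w : R := (W 1 (s j) w - W 0 (s j) w)%R.

Let measurable_gap j : measurable_fun setT (gap j).
Proof. by apply: measurable_funB; exact: mW. Qed.

Let gap0 w : gap 0 w = delta.
Proof. by rewrite /gap /s mul0r !(bm_start (W_bm _)). Qed.

Let gapS j w : gap j.+1 w = (gap j w + gap_step j w)%R.
Proof. by rewrite /gap /gap_step /walk_step; ring. Qed.

Let past m w := (walk_steps 0 m w, walk_steps 1 m w).

Let measurable_past m : measurable_fun setT (past m).
Proof. by apply/measurable_fun_pair; exact: measurable_walk_steps. Qed.

(** The gap as a function of the recorded steps, correct for [j <= m] by [gap_ofE]. Events about the
    gap up to time [m] become events about [past m], of which the next step is independent. *)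
Let gap_of m (v : m.-tuple R * m.-tuple R) j : R :=
  (delta + \sum_(l < m | (l < j)%N) (tnth v.2 l - tnth v.1 l))%R.

Let gap_ofE m j w : (j <= m)%N -> gap_of (past m w) j = gap j w.
Proof.
move=> jm; rewrite /gap_of.
under eq_bigr do rewrite !tnth_mktuple -/(gap_step _ _).
rewrite -(big_ord_widen _ (gap_step ^~ w) jm).
elim: j {jm} => [|j IH]; first by rewrite big_ord0 addr0 gap0.
by rewrite big_ord_recr/= addrA IH gapS.
Qed.

Let measurable_gap_of m j :
  measurable_fun [set: m.-tuple R * m.-tuple R] (fun v => gap_of v j).
Proof.
apply: measurable_funD => //.
rewrite [X in measurable_fun _ X](_ : _ = fun v : m.-tuple R * m.-tuple R =>
   \sum_(l < m) if (l < j)%N then (tnth v.2 l - tnth v.1 l)%R else 0%R)%R; last first.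
  by apply/funext => v; rewrite -big_mkcond.
apply: measurable_sum => l; case: (l < j)%N => //.
have mt : measurable_fun setT (fun v : m.-tuple R => tnth v l).
  exact: measurable_tnth.
apply: measurable_funB.
  exact: (measurableT_comp mt measurable_snd).
exact: (measurableT_comp mt measurable_fst).
Qed.

Let independent_gap m : independent_maps P (past m) (gap_step m).
Proof.
exact: (independent_comp (@measurable_id _ _ setT) msub (@independent_past m)).
Qed.

Variable nu : probability R R.
Hypothesis nuE : forall A, nu A = P (gap_step 0 @^-1` A).

Let nu_law j A : measurable A -> P (gap_step j @^-1` A) = nu A.
Proof. by move=> mA; rewrite nuE !gap_step_law. Qed.

Let integral_nu j psi : measurable_fun [set: R] psi -> (forall y, 0 <= psi y) ->
  \int[P]_w psi (gap_step j w) = \int[nu]_y psi y.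
Proof.
move=> mpsi psi0; rewrite (eq_measure_integral (pushforward P (gap_step j))).
  by rewrite ge0_integral_pushforward.
by move=> A mA _; exact/esym/nu_law.
Qed.

Let integral_nu_opp psi : measurable_fun [set: R] psi -> (forall y, 0 <= psi y) ->
  \int[nu]_y psi (- y)%R = \int[nu]_y psi y.
Proof.
move=> mpsi psi0; rewrite -(integral_nu 0)//; last exact: measurableT_comp.
rewrite [RHS](eq_measure_integral (pushforward P (fun w => - gap_step 0 w)%R)).
- exact: measurableT_comp.
- by move=> ?; rewrite ge0_integral_pushforward//; exact: measurableT_comp.
move=> ? A mA _; transitivity (P (gap_step 0 @^-1` A)); first exact/esym/nu_law.
by rewrite gap_step_law// -(gap_step_law_opp 0).
Qed.

(** In the reflection argument [r] is the number of steps still to be made and [z] the current gap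
    or its mirror image. *)
Definition gap_cdf r z := P [set w | (gap r w - delta < z)%R].

Let lt_set : measurable [set z : R * R | (z.2 < z.1)%R].
Proof.
exact: measurable_lt_set.
Qed.

Let measurable_gap_cdf r : measurable_fun setT (gap_cdf r).
Proof.
have mg : measurable_fun setT (fun w => gap r w - delta)%R.
  exact: measurable_funB.
have [m mE] := law_exists P mg.
rewrite (_ : gap_cdf r = m \o xsection [set z : R * R | (z.2 < z.1)%R]).
  exact: measurable_fun_xsection.
by apply/funext => z /=; rewrite mE; congr (P _); apply/seteqP; split=> w /=;
  rewrite /xsection/= inE.
Qed.

Let gap_cdf_ge0 r z : 0 <= gap_cdf r z.
Proof. exact: measure_ge0. Qed.

Let measurable_gap_lt r z : measurable [set w | (gap r w - delta < z)%R].
Proof.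
by apply: measurable_lt_set => //; exact: measurable_funB.
Qed.

Let gap_cdf_le1 r z : gap_cdf r z <= 1.
Proof. exact: probability_le1. Qed.

Let gap_cdf_le r z z' : (z <= z')%R -> gap_cdf r z <= gap_cdf r z'.
Proof.
by move=> zz'; apply: le_measure; rewrite ?inE// => w /= /lt_le_trans; exact.
Qed.

(** Splitting off the last step gives the average of [gap_cdf r (z - y)]; the symmetry of [nu] turns
    it into z + y, which makes [gap_cdf] space-time harmonic for the gap walk. *)
Let gap_cdfS r z : gap_cdf r.+1 z = \int[nu]_y gap_cdf r (z + y)%R.
Proof.
rewrite -(@integral_nu_opp (fun y => gap_cdf r (z + y)%R))//; last first.
  by apply: measurableT_comp => //; exact: measurable_funD.
rewrite -(integral_nu r)//; last first.
  by apply: measurableT_comp => //; exact: measurable_funB.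
have mg : measurable_fun setT (fun w => gap r w - delta)%R.
  exact: measurable_funB.
have [m mE] := law_exists P mg.
pose E := [set v : R * R | (v.2 + v.1 < z)%R].
have mE' : measurable E.
  by apply: measurable_lt_set => //; exact: measurable_funD.
have ind : independent_maps P (gap_step r) (fun w => gap r w - delta)%R.
  apply: independent_mapsC.
  have := independent_comp (v := id) (measurable_funB (@measurable_gap_of r r) (measurable_cst delta)) (@measurable_id _ _ setT) (@independent_gap r).
  rewrite (_ : _ \o past r = fun w => gap r w - delta)%R//.
  by apply/funext => w /=; rewrite gap_ofE.
transitivity (\int[P]_w (\1_E (gap_step r w, gap r w - delta)%R)%:E).
  rewrite (eq_integral (fun w => (\1_[set w | (gap r.+1 w - delta < z)%R] w)%:E)).
    by rewrite integral_indic ?setIT.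
  move=> w _; congr (_ %:E); rewrite !indicE; congr (_%:R : R); congr nat_of_bool.
  by apply/idP/idP; rewrite !inE /E/= gapS addrAC.
rewrite (@integral_independent _ _ _ P _ _ _ _ (gap_step r)
  (fun w => gap r w - delta)%R m (fun v => (\1_E v)%:E))//.
- apply: eq_integral => w _; rewrite (eq_integral
    (fun y => (\1_[set y | (y + gap_step r w < z)%R] y)%:E)); last first.
    by move=> y _; congr (_ %:E).
  rewrite integral_indic ?setIT//; last first.
    by apply: measurable_lt_set => //; exact: measurable_funD.
  rewrite [LHS]mE; congr (P _); apply/seteqP; split=> w' /=; lra.
- by apply/measurable_EFinP; exact: measurable_indic.
Qed.

Let alive m : set Omega := [set w | forall j, (j <= m)%N -> (0 < gap j w)%R].

Let alive_of m : set (m.-tuple R * m.-tuple R) :=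
  [set v | forall j, (j <= m)%N -> (0 < gap_of v j)%R].

Let measurable_alive_of m : measurable (@alive_of m).
Proof.
rewrite (_ : @alive_of m = \bigcap_(j in [set j | (j <= m)%N])
   [set v | (0 < gap_of v j)%R]); last by apply/seteqP; split.
apply: bigcap_measurable => [|j _]; first by exists 0%N.
exact: (@measurable_lt_set _ _ R (fun=> 0%R) _ (measurable_cst _) (@measurable_gap_of m j)).
Qed.

Let alive_ofE m w : (past m w \in @alive_of m) = (w \in alive m).
Proof.
by apply/idP/idP; rewrite !inE /= => H j jm; have := H j jm; rewrite gap_ofE.
Qed.

Let measurable_alive m : measurable (alive m).
Proof.
have -> : alive m = past m @^-1` @alive_of m; last first.
  exact: (preimage_meas (@measurable_past m) (@measurable_alive_of m)).
apply/seteqP; split=> w; first by move=> /mem_set; rewrite -alive_ofE => /set_mem.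
by move=> H; apply: set_mem; rewrite -alive_ofE; exact/mem_set.
Qed.

Let aliveS m w : (w \in alive m.+1) = (w \in alive m) && (0 < gap m.+1 w)%R.
Proof.
apply/idP/andP => [/set_mem H|[/set_mem H g0]].
  by split; [apply/mem_set => j jm; apply: H; exact: leqW|exact: H].
apply/mem_set => j.
by rewrite leq_eqVlt => /orP[/eqP ->//|]; exact: H.
Qed.

(** Markov property at time [m]: survival and the current gap are functions of the past, and the
    next step is integrated out with its law [nu]. *)
Let integral_gap_step m (psi : R -> \bar R) :
  measurable_fun setT psi -> (forall y, 0 <= psi y) ->
  \int[P]_w ((\1_(alive m) w)%:E * psi (gap m.+1 w)) =
  \int[P]_w ((\1_(alive m) w)%:E * \int[nu]_y psi (gap m w + y)%R).
Proof.
move=> mpsi psi0.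
pose phi (v : (m.-tuple R * m.-tuple R) * R) :=
  (\1_(@alive_of m) v.1)%:E * psi (gap_of v.1 m + v.2)%R.
have mI : measurable_fun setT (fun v : m.-tuple R * m.-tuple R => (\1_(@alive_of m) v)%:E : \bar R).
  by apply/measurable_EFinP/measurable_indic; exact: measurable_alive_of.
have mphi : measurable_fun setT phi.
  apply: emeasurable_funM; first exact: (measurableT_comp mI measurable_fst).
  apply: measurableT_comp => //; apply: measurable_funD => //.
  exact: (measurableT_comp (@measurable_gap_of m m) measurable_fst).
transitivity (\int[P]_w phi (past m w, gap_step m w)).
  by apply: eq_integral => w _; rewrite /phi/= !indicE alive_ofE gap_ofE// gapS.
rewrite (integral_independent (nu := nu))//.
- apply: eq_integral => w _; rewrite /phi/=.
  rewrite ge0_integralZl//.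
  + by rewrite !indicE alive_ofE gap_ofE.
  + by apply: measurableT_comp => //; exact: measurable_funD.
- exact: measurable_past.
- by move=> B mB; exact: nu_law.
- by move=> v; rewrite mule_ge0// lee_fin indicE.
Qed.

Section Reflection.
Variable eps : R.
Hypothesis eps_ge0 : (0 <= eps)%R.

(* Reflection principle: with [F_r := gap_cdf r], the function
   [z |-> F_r z - F_r (- z - 2 * eps)] is harmonic for the gap walk and
   nonnegative on [z >= - eps]. Hence killing the walk once it is nonpositive
   can increase its expectation only through steps below [- eps]. *)
Let below m r := \int[P]_w ((\1_(alive m) w)%:E * gap_cdf r (gap m w)).

Let reflected m r :=
  \int[P]_w ((\1_(alive m) w)%:E * gap_cdf r (- gap m w - 2 * eps)%R).

Let mb m r (f : R -> R) j : measurable_fun setT f ->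
  measurable_fun setT (fun w => (\1_(alive m) w)%:E * gap_cdf r (f (gap j w))).
Proof.
move=> mf; apply: emeasurable_funM.
  by apply/measurable_EFinP; exact: measurable_indic.
by apply: measurableT_comp => //; exact: measurableT_comp.
Qed.

Let mopp : measurable_fun [set: R] (fun z => - z - 2 * eps)%R.
Proof. by apply: measurable_funB => //; exact: measurableT_comp. Qed.

Let ind_ge0 m w (y : \bar R) : 0 <= y -> 0 <= (\1_(alive m) w)%:E * y.
Proof. by move=> y0; rewrite mule_ge0// lee_fin indicE. Qed.

(** The difference of [below] and [reflected] grows by at most one tail of [nu] per step; it is
    written without subtraction. Both terms in [r.+1] are first expressed by the gap at [m.+1] on
    survival up to [m]. A path that also survives at [m.+1] then contributes equally to both sides,
    so that only paths killed at this very step remain to be compared. *)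
Let below_step m r :
  below m.+1 r + reflected m r.+1 <=
  below m r.+1 + reflected m.+1 r + nu [set y : R | (y < - eps)%R].
Proof.
have -> : reflected m r.+1 =
    \int[P]_w ((\1_(alive m) w)%:E * gap_cdf r (- gap m.+1 w - 2 * eps)%R).
  rewrite (@integral_gap_step m (fun z => gap_cdf r (- z - 2 * eps)%R))//; last first.
    exact: measurableT_comp.
  apply: eq_integral => w _; congr (_ * _); rewrite gap_cdfS -integral_nu_opp//.
    by apply: eq_integral => y _; congr (gap_cdf _ _); ring.
  by apply: measurableT_comp => //; exact: measurable_funD.
have -> : below m r.+1 = \int[P]_w ((\1_(alive m) w)%:E * gap_cdf r (gap m.+1 w)).
  rewrite (@integral_gap_step m (gap_cdf r))//.
  by apply: eq_integral => w _; rewrite gap_cdfS.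
have mE : measurable (gap_step m @^-1` [set y : R | (y < - eps)%R]).
  by apply: preimage_meas => //; exact: measurable_lt_set.
rewrite -(nu_law m); last exact: measurable_lt_set.
set E := gap_step m @^-1` _.
have -> : P E = \int[P]_w (\1_E w)%:E by rewrite integral_indic// setIT.
have mI m' := @mb m' r id m.+1 (@measurable_id _ _ setT).
have mO m' := @mb m' r _ m.+1 mopp.
have mG : measurable_fun setT (fun w => (\1_E w)%:E : \bar R).
  by apply/measurable_EFinP; exact: measurable_indic.
have mIO : measurable_fun setT (fun w => (\1_(alive m) w)%:E * gap_cdf r (gap m.+1 w)
   + (\1_(alive m.+1) w)%:E * gap_cdf r (- gap m.+1 w - 2 * eps)%R).
  exact: emeasurable_funD.
rewrite /below /reflected -!ge0_integralD//; try by move=> w _; rewrite ?adde_ge0// ?ind_ge0.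
apply: ge0_le_integral => //.
- by move=> w _; rewrite adde_ge0// ind_ge0.
- exact: emeasurable_funD.
- exact: emeasurable_funD.
move=> w _; rewrite !indicE aliveS.
have [wm|] := boolP (w \in alive m); last first.
  by rewrite !mul0e !add0e.
rewrite !mul1e /=; case: ltP => g0.
  by rewrite !mul1e leeDl.
rewrite !mul0e add0e adde0.
(* If the new gap g is at least - eps, its mirror image - g - 2 eps is at most g. Otherwise the step
   itself is below - eps, since the previous gap was positive, and the bound 1 suffices. *)
have [le|lt] := leP (- eps)%R (gap m.+1 w).
  apply: le_trans (leeDl _ _) => //; apply: gap_cdf_le; lra.
have -> : w \in E.
  rewrite inE/E/=; have := gapS m w.
  by move: wm; rewrite inE => /(_ m (leqnn m)); lra.
by apply: le_trans (leeDr _ _) => //.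
Qed.

Let le1_fin_num (y : \bar R) : 0 <= y -> y <= 1 -> y \is a fin_num.
Proof. by move=> y0 y1; rewrite ge0_fin_numE// (le_lt_trans y1)// ltry. Qed.

Let integral_fin_num m (f : Omega -> \bar R) :
  measurable_fun setT (fun w => (\1_(alive m) w)%:E * f w) ->
  (forall w, 0 <= f w) -> (forall w, f w <= 1) ->
  \int[P]_w ((\1_(alive m) w)%:E * f w) \is a fin_num.
Proof.
move=> mf f0 f1; apply: le1_fin_num.
  by apply: integral_ge0 => w _; exact: ind_ge0.
apply: (@le_trans _ _ (\int[P]_w cst 1 w)); last first.
  by rewrite integral_cst//= probability_setT mule1.
apply: ge0_le_integral => //; first by move=> w _; exact: ind_ge0.
by move=> w _ /=; rewrite indicE; case: (w \in _); rewrite ?mul1e ?mul0e.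
Qed.

Let below_fin m r : below m r \is a fin_num.
Proof.
by apply: integral_fin_num => //; exact: (mb m r m (@measurable_id _ _ setT)).
Qed.

Let reflected_fin m r : reflected m r \is a fin_num.
Proof. by apply: integral_fin_num => //; exact: (mb m r m mopp). Qed.

Hypothesis delta_gt0 : (0 < delta)%R.

Let gap_cdf0 z : gap_cdf 0 z = ((0 < z)%R%:R : R)%:E.
Proof.
rewrite /gap_cdf; have [z0|z0] := ltP 0%R z.
  by rewrite (_ : mkset _ = setT) ?probability_setT//; apply/seteqP; split => // w _ /=; rewrite gap0 subrr.
rewrite (_ : mkset _ = set0) ?measure0//; apply/seteqP; split => // w /=.
by rewrite gap0 subrr ltNge z0.
Qed.

Let below0 n : below n 0 = P (alive n).
Proof.
rewrite -[alive n]setIT -integral_indic//; apply: eq_integral => w _.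
rewrite indicE; have [wn|] := boolP (w \in alive n); last by rewrite mul0e.
by rewrite gap_cdf0 (set_mem wn n (leqnn n)) mule1.
Qed.

Let reflected0 n : reflected n 0 = 0.
Proof.
apply: integral0_eq => w _; rewrite indicE.
have [wn|] := boolP (w \in alive n); last by rewrite mul0e.
rewrite gap_cdf0 (_ : (_ < _)%R = false) ?mule0//; apply/negbTE; rewrite -leNgt.
have g0 : (0 < gap n w)%R by exact: (set_mem wn n (leqnn n)).
by move: eps_ge0 g0; lra.
Qed.

Let alive0 w : w \in alive 0.
Proof. by apply/mem_set => j; rewrite leqn0 => /eqP ->; rewrite gap0. Qed.

Let below_start n : below 0 n = gap_cdf n delta.
Proof.
rewrite /below (eq_integral (cst (gap_cdf n delta))).
  by rewrite integral_cst//= probability_setT mule1.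
by move=> w _; rewrite indicE alive0 mul1e gap0.
Qed.

Let reflected_start n : reflected 0 n = gap_cdf n (- delta - 2 * eps)%R.
Proof.
rewrite /reflected (eq_integral (cst (gap_cdf n (- delta - 2 * eps)%R))).
  by rewrite integral_cst//= probability_setT mule1.
by move=> w _; rewrite indicE alive0 mul1e gap0.
Qed.

(** [below_step] is iterated with r = n - m. At m = 0 both functionals are values of a distribution
    function, at delta and at - delta - 2 eps; at r = 0 no displacement is left, so [below] is the
    survival probability and [reflected] vanishes. *)
Lemma alive_le n :
  P [set w | forall j, (j <= n)%N -> (0 < gap j w)%R] +
    P [set w | (gap n w - delta < - delta - 2 * eps)%R] <=
  P [set w | (gap n w - delta < delta)%R] +
    n%:R%:E * nu [set y | (y < - eps)%R].
Proof.
rewrite -/(alive n) -below0 -/(gap_cdf _ _) -/(gap_cdf _ _).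
rewrite -below_start -reflected_start.
have nu_fin : nu [set y | (y < - eps)%R] \is a fin_num.
  by apply: fin_num_measure; exact: measurable_lt_set.
suff H m : (m <= n)%N -> below m (n - m) + reflected 0 n <=
    below 0 n + reflected m (n - m) + m%:R%:E * nu [set y | (y < - eps)%R].
  by have := H n (leqnn n); rewrite subnn reflected0 adde0.
elim: m => [_|m IH mn]; first by rewrite subn0 mul0e adde0.
have := below_step m (n - m.+1); rewrite -subSn// subSS.
have := IH (ltnW mn).
rewrite -(fineK (below_fin m _)) -(fineK (below_fin 0 _)) -(fineK (below_fin m.+1 _)).
rewrite -(fineK (reflected_fin m _)) -(fineK (reflected_fin 0 _)) -(fineK (reflected_fin m.+1 _)).
rewrite -(fineK nu_fin) -!EFinM -!EFinD !lee_fin -natr1; lra.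
Qed.

End Reflection.
End RandomWalk.

(** * From the sampled walk to continuous paths *)

Section Meeting.
Context {R : realType} {d} {Omega : measurableType d} (P : probability Omega R).
Context (x : nat -> R) (W : nat -> R -> Omega -> R).
Hypothesis W_bm : forall i, (i < 2)%N -> brownian_motion P (x i) (W i).
Hypothesis W_indep : independent_processes P 2 W.

Lemma normal_law_exists (h : R) : 0 < h -> exists N : probability R R,
  forall A, measurable A -> N A = normal_prob 0 (Num.sqrt h) A.
Proof.
move=> h0; have mW : measurable_fun setT (fun w => W 0 h w - W 0 0 w).
  by apply: measurable_funB; apply: (bm_measurable (W_bm _)) => //; exact: ltW.
have [N NE] := law_exists P mW.
exists N => A mA; rewrite NE.
have := bm_normal (W_bm (isT : (0 < 2)%N)) (lexx 0) h0 mA; rewrite subr0.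
exact.
Qed.

(** The gap starts positive, so by the intermediate value theorem a nonpositive sample would force a
    meeting before it. *)
Lemma gap_gt0 (t h : R) (n : nat) w : x 0%N < x 1%N -> n%:R * h <= t -> 0 < h ->
  (forall r, 0 <= r <= t -> W 0 r w <> W 1 r w) ->
  forall j, (j <= n)%N -> 0 < gap W h j w.
Proof.
move=> x01 nh h0 noc j jn; rewrite ltNge; apply/negP => gj.
have jh0 : 0 <= j%:R * h by rewrite mulr_ge0// ltW.
have jt : j%:R * h <= t.
  by apply: le_trans nh; rewrite ler_wpM2r ?ler_nat// ltW.
have cW i : (i < 2)%N -> {within `[0, j%:R * h], continuous (W i ^~ w)}.
  move=> i2.
  have H : {within `[0, +oo[, continuous (W i ^~ w)} by case: (W_bm i2) => _ _ H _ _; exact: H.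
  apply: (continuous_subspaceW _ H).
  by move=> r /=; rewrite !in_itv/= => /andP[-> _].
have cf : {within `[0, j%:R * h], continuous (fun r => W 1 r w - W 0 r w)}.
  by move=> r; apply: cvgB; exact: cW.
have [|r rj fr0] := @IVT R _ 0 (j%:R * h) 0 jh0 cf.
  rewrite !(bm_start (W_bm _))// ge_min le_max gj orbT/= subr_ge0.
  by rewrite (ltW x01).
apply: (noc r).
  by move: rj; rewrite in_itv/= => /andP[-> /le_trans]; exact.
by apply/esym/eqP; rewrite -subr_eq0 fr0.
Qed.

(** With delta the initial gap, the first term is the density peak times the length of [- delta - 2
    eps, delta[, the interval left between the two distribution functions of [alive_le]. The second
    is n + 1 times the tail bound for a gap step of mesh t / (n + 1). *)
Lemma no_meeting_bound (t eps : R) (n : nat) (E : set Omega) :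
  0 < t -> x 0%N < x 1%N -> 0 < eps -> measurable E ->
  (forall w, E w -> forall r, 0 <= r <= t -> W 0 r w <> W 1 r w) ->
  fine (P E) <= 2 * (x 1%N - x 0%N + eps) * normal_peak (Num.sqrt t) +
    (16 * (16 * t / eps ^+ 2) ^+ 2) / n.+1%:R.
Proof.
move=> t0 x01 e0 mE noc.
pose h := t / n.+1%:R.
have h0 : 0 < h by rewrite divr_gt0.
have nh : n.+1%:R * h = t by rewrite mulrC divfK.
have [N NE] := normal_law_exists h0.
have [Nt NtE] := normal_law_exists t0.
have mg : measurable_fun setT (gap_step W h 0).
  rewrite /gap_step /walk_step.
  by apply: measurable_funB; apply: measurable_funB; apply: (bm_measurable (W_bm _)) => //; rewrite mulr_ge0// ltW.
have [nu nuE] := law_exists P mg.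
have d0 : 0 < x 1%N - x 0%N by rewrite subr_gt0.
have H := alive_le h0 W_bm W_indep NE nuE (ltW e0) d0 n.+1.
have nule : (nu [set y | (y < - eps)%R] <= (4 * (4 / ((eps / 2) ^+ 2 / (4 * h)) ^+ 2))%:E)%E.
  rewrite nuE (gap_step_law h0 W_bm W_indep NE); last exact: measurable_lt_set.
  have := normal_difference_tail NE _ e0; rewrite sqrtr_gt0 => /(_ h0).
  by rewrite set_itvE sqr_sqrtr// ltW.
have diff : (P [set w | (gap W h n.+1 w - (x 1%N - x 0%N) < x 1%N - x 0%N)%R] <=
   P [set w | (gap W h n.+1 w - (x 1%N - x 0%N) < - (x 1%N - x 0%N) - 2 * eps)%R] +
   (2 * (x 1%N - x 0%N + eps) * normal_peak (Num.sqrt t))%:E)%E.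
  (* The n + 1 steps of mesh [h] add up to a single step of mesh [t], so the interval estimate
     applies with standard deviation sqrt t. *)
  have gE w : gap W h n.+1 w - (x 1%N - x 0%N) = gap_step W t 0 w.
    rewrite /gap /gap_step /walk_step mul0r mul1r nh !(bm_start (W_bm _))//; ring.
  have mgt : measurable_fun setT (gap_step W t 0).
    rewrite /gap_step /walk_step.
    by apply: measurable_funB; apply: measurable_funB; apply: (bm_measurable (W_bm _)) => //; rewrite mulr_ge0// ltW.
  under eq_set do rewrite gE.
  under [X in (_ <= P X + _)%E]eq_set do rewrite gE.
  pose I : set R := [set` `[(- (x 1%N - x 0%N) - 2 * eps)%R, (x 1%N - x 0%N)%R[ ].
  have mI : measurable (gap_step W t 0 @^-1` I).
    exact: (preimage_meas mgt (measurable_itv _)).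
  apply: (@le_trans _ _ (P ([set w | gap_step W t 0 w < - (x 1%N - x 0%N) - 2 * eps]
      `|` gap_step W t 0 @^-1` I))).
    apply: le_measure; rewrite ?inE.
    - exact: measurable_lt_set.
    - by apply: measurableU => //; exact: measurable_lt_set.
    move=> w /= wd; case: (ltP (gap_step W t 0 w) (- (x 1%N - x 0%N) - 2 * eps)) => ge; first by left.
    by right; rewrite /I/= in_itv/= ge.
  apply: (le_trans (measureU2 P _ mI)); first exact: measurable_lt_set.
  apply: leeD => //.
  rewrite [leLHS](gap_step_law t0 W_bm W_indep NtE); last exact: measurable_itv.
  have -> : 2 * (x 1%N - x 0%N + eps) = x 1%N - x 0%N - (- (x 1%N - x 0%N) - 2 * eps) by ring.
  apply: normal_difference_itv_le => //; first by rewrite gt_eqF// sqrtr_gt0.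
  by lra.
have mgap j : measurable_fun setT (gap W h j).
  by apply: measurable_funB; apply: (bm_measurable (W_bm _)) => //; rewrite mulr_ge0// ltW.
have PE : (P E <= P [set w | forall j, (j <= n.+1)%N -> (0 < gap W h j w)%R])%E.
  apply: le_measure; rewrite ?inE//.
    rewrite (_ : mkset _ = \bigcap_(j in [set j | (j <= n.+1)%N])
      [set w | 0 < gap W h j w]); last by apply/seteqP; split.
    apply: bigcap_measurable => [|j _]; first by exists 0%N.
    exact: (@measurable_lt_set _ _ R (fun=> 0) _ (measurable_cst _)).
  move=> w Ew /=; apply: (gap_gt0 x01 _ h0 (noc w Ew)).
  by rewrite nh.
have fin A : measurable A -> P A \is a fin_num by exact: fin_num_measure.
have mlt z : measurable [set w | gap W h n.+1 w - (x 1%N - x 0%N) < z].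
  by apply: measurable_lt_set => //; exact: measurable_funB.
move: (le_trans (leeD PE (lexx _)) H) diff nule.
set a := P E; set b := P _; set c := P _; set e := nu _.
have fa : a \is a fin_num by exact: fin.
have fb : b \is a fin_num by apply: fin; exact: mlt.
have fc : c \is a fin_num by apply: fin; exact: mlt.
have fe : e \is a fin_num by apply: fin_num_measure; exact: measurable_lt_set.
rewrite -(fineK fa) -(fineK fb) -(fineK fc) -(fineK fe) -!EFinM -!EFinD !lee_fin.
move=> H1 H2 H3.
have H4 : n.+1%:R * fine e <= 16 * (16 * t / eps ^+ 2) ^+ 2 / n.+1%:R.
  apply: (@le_trans _ _ (n.+1%:R * (4 * (4 / ((eps / 2) ^+ 2 / (4 * h)) ^+ 2)))).
    by rewrite ler_wpM2l.
  rewrite /h le_eqVlt; apply/orP; left; apply/eqP; field.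
  by rewrite !gt_eqF.
rewrite /= in H1 H2 *; set Y := _ / n.+1%:R in H4 *.
set Z := n.+1%:R * fine e in H1 H4.
by move: H1 H2 H4; clear; lra.
Qed.

Lemma no_meeting_le (t : R) (E : set Omega) :
  0 < t -> x 0%N < x 1%N -> measurable E ->
  (forall w, E w -> forall r, 0 <= r <= t -> W 0 r w <> W 1 r w) ->
  (P E <= (2 * (x 1%N - x 0%N) * normal_peak (Num.sqrt t))%:E)%E.
Proof.
move=> t0 x01 mE noc.
have PE : P E \is a fin_num by exact: fin_num_measure.
rewrite -(fineK PE) lee_fin; apply/ler_addgt0Pr => e e0.
pose c := normal_peak (Num.sqrt t).
have c0 : 0 <= c by exact: normal_peak_ge0.
(* [eps] and [n] make each of the two errors at most e / 2; adding 1 keeps the divisor positive from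
   [0 <= c] alone. *)
pose eps := e / 2 / (2 * c + 1).
have c1 : 0 < 2 * c + 1 by lra.
have eps0 : 0 < eps by rewrite !divr_gt0.
pose K := 16 * (16 * t / eps ^+ 2) ^+ 2.
have K0 : 0 <= K by rewrite mulr_ge0// sqr_ge0.
pose n := Num.bound (K / (e / 2)).
have Kn : K / n.+1%:R <= e / 2.
  rewrite ler_pdivrMr// mulrC -ler_pdivrMr ?divr_gt0//.
  have : K / (e / 2) < n%:R by apply: archi_boundP; rewrite divr_ge0// ltW// divr_gt0.
  by rewrite -natr1; lra.
have := no_meeting_bound n t0 x01 eps0 mE noc.
rewrite -/K -/c; set q := K / _ in Kn *.
have : 2 * eps * c <= e / 2.
  have -> : e / 2 = eps * (2 * c + 1) by rewrite /eps divfK// gt_eqF.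
  by nra.
by lra.
Qed.

End Meeting.

(** * Measurability of the meeting of two continuous paths *)

Section MeetingEvents.
Context {R : realType} {d} {Omega : measurableType d}.
Implicit Types A B : R -> Omega -> R.

Lemma within_continuous_dist (f : R -> R) (D : set R) (r e : R) :
  {within D, continuous f} -> D r -> 0 < e ->
  exists2 dl, 0 < dl & forall q, D q -> `|r - q| < dl -> `|f r - f q| < e.
Proof.
move=> cf Dr e0; have /cvgrPdist_lt/(_ e e0) := cf r.
move=> H; have {}H : nbhs_subspace (r : subspace D) (fun q => `|f r - f q| < e) by exact: H.
move: H; rewrite -nbhs_subspace_in// => /nbhs_ballP[dl/= dl0 H].
by exists dl => // q Dq rq; exact: H.
Qed.

Definition meeting A B (s : R) : set Omega :=
  [set w | exists r, [/\ 0 <= r, r <= s & A r w = B r w]].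

(** On the compact interval [0, s] the continuous function |A - B| attains its minimum. The paths
    thus meet exactly when |A - B| falls below every 1 / (m + 1) at some grid point, which is a
    countable condition. *)
Lemma measurable_meeting A B s : 0 <= s ->
  (forall r, 0 <= r -> measurable_fun setT (A r)) ->
  (forall r, 0 <= r -> measurable_fun setT (B r)) ->
  (forall w, {within `[0, +oo[, continuous (A ^~ w)}) ->
  (forall w, {within `[0, +oo[, continuous (B ^~ w)}) ->
  measurable (meeting A B s).
Proof.
move=> s0 mA mB cA cB.
(* [minn] keeps every grid point in [0, s], so that [i] may range over all naturals. *)
pose q n i : R := (minn i n.+1)%:R / n.+1%:R * s.
have q0 n i : 0 <= q n i by rewrite mulr_ge0// divr_ge0.
have qs n i : q n i <= s.
  by rewrite ler_piMl// ler_pdivrMr// mul1r ler_nat geq_minr.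
have cf w : {within `[0, s], continuous (fun r => A r w - B r w)}.
  move=> r; apply: cvgB.
    apply: (continuous_subspaceW _ (cA w)) => u /=.
    by rewrite !in_itv/= => /andP[->].
  apply: (continuous_subspaceW _ (cB w)) => u /=.
  by rewrite !in_itv/= => /andP[->].
rewrite (_ : meeting A B s = \bigcap_m \bigcup_n \bigcup_i
    [set w | `|A (q n i) w - B (q n i) w| < m.+1%:R^-1]).
  apply: bigcapT_measurable => m; apply: bigcupT_measurable => n.
  apply: bigcupT_measurable => i; apply: measurable_lt_set => //.
  by apply: measurableT_comp => //; apply: measurable_funB; [exact: mA|exact: mB].
apply/seteqP; split=> w /=.
  move=> [r [r0 rs ABr]] m _.
  have rI : [set` `[0, s]] r by rewrite /= in_itv/= r0 rs.
  have m0 : 0 < m.+1%:R^-1 :> R by rewrite invr_gt0.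
  have [dl dl0 H] := within_continuous_dist (cf w) rI m0.
  have [s00|s_gt0] := eqVneq s 0.
    exists 0%N => //; exists 0%N => //=; rewrite /q min0n mul0r mul0r.
    move: rs; rewrite s00 => rs; have -> : 0 = r by lra.
    by rewrite ABr subrr normr0.
  have {s_gt0}s_gt0 : 0 < s by rewrite lt_def s_gt0.
  pose n := Num.bound (s / dl).
  pose i := Num.truncn (r / s * n.+1%:R).
  exists n => //; exists i => //=.
  have rsn : 0 <= r / s * n.+1%:R by rewrite mulr_ge0// divr_ge0.
  have /andP[i1 i2] := truncn_itv rsn.
  have in1 : (i <= n.+1)%N.
    rewrite -(ler_nat R); apply: le_trans i1 _.
    by rewrite ler_piMl// ler_pdivrMr// mul1r.
  have qE : q n i = i%:R / n.+1%:R * s by rewrite /q (minn_idPl in1).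
  have := H (q n i); rewrite ABr subrr sub0r normrN; apply.
    by rewrite /= in_itv/= q0 qs.
  have sn : s / n.+1%:R < dl.
    rewrite ltr_pdivrMr// mulrC -ltr_pdivrMr//.
    have : s / dl < n%:R by apply: archi_boundP; rewrite divr_ge0// ltW.
    by rewrite -natr1; lra.
  have qr : q n i <= r.
    by rewrite qE -ler_pdivlMr// ler_pdivrMr.
  have rq : r < q n i + s / n.+1%:R.
    rewrite qE (_ : _ + _ = (i%:R + 1) / n.+1%:R * s); last by rewrite !mulrDl mul1r [_^-1 * s]mulrC.
    by rewrite -ltr_pdivrMr// ltr_pdivlMr// natr1.
  rewrite ger0_norm ?subr_ge0//; move: rq sn; set v := s / _.
  by move: (q n i) => z; clear; lra.
move=> H.
have cn : {within `[0, s], continuous (fun r => `|A r w - B r w|)}.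
  by move=> r; apply: cvg_norm; exact: cf.
have [c cI cmin] := EVT_min s0 cn.
exists c; move: (cI); rewrite in_itv/= => /andP[-> ->]; split => //.
apply/eqP; rewrite -subr_eq0 -normr_eq0 eq_le normr_ge0 andbT leNgt.
apply/negP => c0.
have /(_ I)[n _ [i _ /=]] := H (Num.bound (`|A c w - B c w|^-1)).
apply/negP; rewrite -leNgt; apply: le_trans (cmin (q n i) _); last first.
  by rewrite in_itv/= q0 qs.
rewrite invf_ple ?posrE//; apply: ltW.
apply: (@lt_trans _ _ (Num.bound (`|A c w - B c w|^-1))%:R).
  by apply: archi_boundP; rewrite invr_ge0.
by rewrite ltr_nat.
Qed.

End MeetingEvents.

(** * The image of the flow *)

Section Coalescence.
Context {R : realType} {d} {Omega : measurableType d} (P : probability Omega R).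
Context (X : R -> R -> Omega -> R).
Hypothesis flow : arratia_flow P X.

(** The flow is compared with its model at the single time [t], where the pairs have the same law.
    Model paths that differ at [t] have not met before, since [coalesce] makes the second follow the
    first after a meeting. *)
Lemma coalescence_bound (a b t : R) : 0 < t -> 0 <= a -> a < b -> b <= 1 ->
  (P [set w | X a t w <> X b t w] <=
    (2 * (b - a) * normal_peak (Num.sqrt t))%:E)%E.
Proof.
move=> t0 a0 ab b1.
have st : sorted <%R [:: a; b] by rewrite /= ab.
have u01 : {in [:: a; b], forall x, 0 <= x <= 1}.
  move=> x; rewrite !inE => /orP[] /eqP ->.
    by rewrite a0 (le_trans (ltW ab)).
  by rewrite b1 (le_trans a0 (ltW ab)).
have [d2 [ Omega2 [P2 [W [bmW indW fdd]]]]] := af_coalescing flow st u01.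
pose x i := nth 0 [:: a; b] i.
have t0' := ltW t0.
have mW i r : (i < 2)%N -> 0 <= r -> measurable_fun setT (W i r).
  by move=> i2 r0; apply: (bm_measurable (bmW i i2)).
have cW i w : (i < 2)%N -> {within `[0, +oo[, continuous (W i ^~ w)}.
  by move=> i2; case: (bmW i i2) => _ _ H _ _; exact: H.
pose M := meeting (W 1%N) (W 0%N) t.
have mM : measurable M.
  apply: measurable_meeting => //.
  - by move=> r; exact: mW.
  - by move=> r; exact: mW.
  - by move=> w; exact: cW.
  - by move=> w; exact: cW.
pose Y i w := coalesce (fun j r => W j r w) i t.
have Y0E : Y 0%N = W 0%N t by [].
have Y1E w : Y 1%N w = if w \in M then W 0%N t w else W 1%N t w.
  rewrite /Y/=; have [wM|wM] := boolP (w \in M).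
    by rewrite ifT//; apply/asboolP; exact: (set_mem wM).
  by rewrite ifF//; apply/asboolP => H; move: wM; rewrite mem_set.
have mY1 : measurable_fun setT (Y 1%N).
  rewrite (_ : Y 1%N = fun w => if w \in M then W 0%N t w else W 1%N t w); last first.
    by apply/funext => w; exact: Y1E.
  apply: measurable_fun_ifT; [|exact: mW|exact: mW].
  apply: (measurable_fun_bool true); rewrite setTI.
  rewrite (_ : _ @^-1` _ = M)//.
  by apply/seteqP; split=> w /=; [move/set_mem|move/mem_set ->].
have mX u : 0 <= u <= 1 -> measurable_fun setT (X u t).
  by move=> u1; exact: (af_measurable flow).
have ma : 0 <= a <= 1 by apply: u01; rewrite !inE eqxx.
have mb : 0 <= b <= 1 by apply: u01; rewrite !inE eqxx orbT.
have mf : measurable_fun setT (fun w => (X a t w, X b t w)).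
  by apply/measurable_fun_pair; exact: mX.
have mg : measurable_fun setT (fun w => (Y 0%N w, Y 1%N w)).
  by apply/measurable_fun_pair => //; exact: mW.
have [m mE] := law_exists P mf.
have [m' mE'] := law_exists P2 mg.
(* [same_fdd] covers rectangles only; uniqueness of measures carries the equality to the
   off-diagonal set [D]. *)
have mm' A : measurable A -> m A = m' A.
  move=> mA; apply: (measure_unique_setT (G := rectangles R R) (m1 := m) (m2 := m') _ _ _ _ _ mA).
  - exact: measurable_prod_measurableType.
  - exact: rectanglesI.
  - exact: rectanglesT.
  - move=> _ [B mB [C mC <-]].
    rewrite [LHS]mE [RHS]mE'.
    have mBC i (j : nat) : measurable (if i == 0%N then B else C) by case: ifP.
    have := fdd 1%N (fun=> t) (fun i _ => if i == 0%N then B else C) (fun=> t0') mBC.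
    congr (_ = _); congr (_ _); apply/seteqP; split=> w /=.
    + by move=> H; split; [exact: (H 0%N 0%N)|exact: (H 1%N 0%N)].
    + by move=> [H1 H2] [|[|//]] j.
    + by move=> H; split; [exact: (H 0%N 0%N)|exact: (H 1%N 0%N)].
    + by move=> [H1 H2] [|[|//]] j.
  - by rewrite [ltLHS]probability_setT ltry.
pose D := [set z : R * R | z.1 <> z.2].
have mD : measurable D.
  rewrite (_ : D = ~` [set z : R * R | z.1 = z.2])//.
  by apply: measurableC; exact: measurable_eq_set.
have -> : P [set w | X a t w <> X b t w] = P2 [set w | Y 0%N w <> Y 1%N w].
  by rewrite -[LHS](mE D) mm'// mE'.
apply: (@le_trans _ _ (P2 (~` M))).
  apply: le_measure; rewrite ?inE.
  - exact: (preimage_meas mg mD).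
  - exact: measurableC.
  - by move=> w /= H wM; apply: H; rewrite Y0E Y1E mem_set.
apply: (no_meeting_le (P := P2) (x := x) (W := W)) => //.
- exact: measurableC.
- by move=> w /= wM r /andP[r0 rt] E; apply: wM; exists r.
Qed.

End Coalescence.

(** * Counting values along a partition *)

Section Partitions.
Context {R : realType}.

(** An entry kept by [undup] does not recur to its right, so unless it is the last one it differs
    from its right neighbour. *)
Lemma size_undup_changes (T : eqType) (x0 : T) (s : seq T) :
  (size (undup s) <=
    (\sum_(j < (size s).-1) (nth x0 s j != nth x0 s j.+1)).+1)%N.
Proof.
elim: s => [//|x [|y s] IH] //=.
rewrite big_ord_recl/=; rewrite /= in IH.
have [->|xy] := eqVneq x y.
  by rewrite in_cons eqxx/= add0n; exact: IH.
rewrite add1n; case: ifP => _; first exact: leq_trans IH _.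
by rewrite /= ltnS; exact: IH.
Qed.

Lemma separated_from (s : seq R) (x : R) :
  exists2 e, 0 < e & forall v, v \in s -> v != x -> e <= `|v - x|.
Proof.
elim: s => [|y s [e e0 IH]]; first by exists 1.
have [->|yx] := eqVneq y x.
  by exists e => // v; rewrite in_cons => /orP[/eqP ->|/IH]//; rewrite eqxx.
exists (Num.min e `|y - x|).
  by rewrite lt_min e0 normr_gt0 subr_eq0.
move=> v; rewrite in_cons => /orP[/eqP -> _|vs vx]; first by rewrite ge_min lexx orbT.
by rewrite ge_min IH.
Qed.

Lemma sorted_lt_itv (s : seq R) z : sorted <%R s -> z \in s ->
  nth 0 s 0 <= z <= nth 0 s (size s).-1.
Proof.
move=> ss zs.
have zi : (index z s < size s)%N by rewrite index_mem.
have s0 : (0 < size s)%N by apply: leq_ltn_trans zi.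
have -> : z = nth 0 s (index z s) by rewrite nth_index.
by rewrite !(lt_sorted_leq_nth 0 ss) ?inE ?prednK//= -ltnS prednK.
Qed.

(** The first point beyond [u] works: it is not the initial point 0, and its predecessor is at most
    [u], so its distance to [u] is at most the mesh. *)
Lemma mesh_point (s : seq R) u v :
  sorted <%R s -> nth 0 s 0 = 0 -> nth 0 s (size s).-1 = 1 -> (0 < size s)%N ->
  0 <= u -> u < 1 ->
  \big[Num.max/0]_(j < (size s).-1) (nth 0 s j.+1 - nth 0 s j) < v - u ->
  exists z, [/\ z \in s, u < z & z < v].
Proof.
move=> ss s0 s1 size0 u0 u1 mesh.
pose j := find (fun z => u < z) s.
have hs : has (fun z => u < z) s.
  by apply/hasP; exists 1 => //; rewrite -s1 mem_nth// prednK.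
have js : (j < size s)%N by rewrite -has_find.
have uj : u < nth 0 s j by exact: nth_find.
exists (nth 0 s j); split=> //; first exact: mem_nth.
case: (posnP j) => [j0|j0]; first by move: uj; rewrite j0 s0 ltNge u0.
have jm : (j.-1 < (size s).-1)%N by rewrite -ltnS !prednK.
have := @before_find _ 0 (fun z => u < z) s j.-1; rewrite prednK// => /(_ (leqnn _)).
move/negbT; rewrite -leNgt => ju.
have := @le_bigmax _ _ _ 0 (fun i : 'I_(size s).-1 => nth 0 s i.+1 - nth 0 s i) (Ordinal jm).
rewrite /= prednK// => le; move: (le_lt_trans le mesh); lra.
Qed.

Lemma telescope_nth (s : seq R) :
  \sum_(j < (size s).-1) (nth 0 s j.+1 - nth 0 s j) =
  nth 0 s (size s).-1 - nth 0 s 0.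
Proof.
rewrite -(big_mkord xpredT (fun j => nth 0 s j.+1 - nth 0 s j)).
by rewrite telescope_sumr.
Qed.

(** The bound holds along a subsequence only, which is enough to bound a nondecreasing count. *)
Lemma limn_einf_lty (u : (\bar R)^nat) : (limn_einf u < +oo)%E ->
  exists K : R, forall n, exists2 m, (n <= m)%N & (u m < K%:E)%E.
Proof.
move=> uoo; have [K uK] : exists K : R, (limn_einf u < K%:E)%E.
  case: (limn_einf u) uoo => [r|//|] _; last by exists 0; exact: ltNyr.
  by exists (r + 1); rewrite lte_fin ltrDl.
exists K => n.
have : (einfs u n < K%:E)%E.
  apply: le_lt_trans uK; rewrite limn_einf_lim.
  rewrite (cvg_lim _ (@cvg_einfs_sup R u))//.
  by apply: ereal_sup_ubound; exists n.
by move=> /ereal_inf_lt[_ [m /= nm <-] h]; exists m.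
Qed.

End Partitions.

(** * Almost sure stabilisation of the image *)

Section FiniteImage.
Context {R : realType} {d} {Omega : measurableType d} (P : probability Omega R).
Context (X : R -> R -> Omega -> R) (t : R) (U : forall n : nat, n.-tuple R).
Hypothesis flow : arratia_flow P X.
Hypothesis t_gt0 : 0 < t.
Hypothesis U_sorted : forall n, (2 <= n)%N -> sorted <%R (U n).
Hypothesis U_first : forall n, (2 <= n)%N -> nth 0 (U n) 0 = 0.
Hypothesis U_last : forall n, (2 <= n)%N -> nth 0 (U n) n.-1 = 1.
Hypothesis U_sub : forall n, (2 <= n)%N -> {subset U n <= U n.+1}.
Hypothesis U_mesh :
  (fun n => \big[Num.max/0]_(j < n.-1) (nth 0 (U n) j.+1 - nth 0 (U n) j))
    @ \oo --> 0.

Lemma partition_itv n u : (2 <= n)%N -> u \in U n -> 0 <= u <= 1.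
Proof.
move=> n2 un; have := sorted_lt_itv (U_sorted n2) un.
by rewrite size_tuple U_first// U_last.
Qed.

Lemma partition_subset m n : (2 <= m)%N -> (m <= n)%N -> {subset U m <= U n}.
Proof.
move=> m2; elim: n => [|n IH]; first by rewrite leqn0 => /eqP ->.
rewrite leq_eqVlt => /orP[/eqP -> //|mn] u um.
by apply: U_sub (IH mn u um); exact: leq_trans m2 mn.
Qed.

Definition partition_image n w : set R := [set X u t w | u in [set` U n]].

Definition image_seq n w : seq R := [seq X u t w | u <- U n].

Lemma partition_imageE n w : partition_image n w = [set` image_seq n w].
Proof.
apply/seteqP; split=> v /=.
  by move=> [u un <-]; exact: map_f.
by move=> /mapP[u un ->]; exists u.
Qed.

Lemma image_seq_subset m n w : (2 <= m)%N -> (m <= n)%N ->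
  {subset image_seq m w <= image_seq n w}.
Proof.
by move=> m2 mn v /mapP[u um ->]; apply: map_f; exact: (partition_subset m2 mn).
Qed.

(** A value outside the stabilised finite set would be at positive distance from it.
    Right-continuity and the vanishing mesh however give a partition point slightly to the right of
    [u] whose value is closer than that. *)
Lemma flow_image_finite w n0 : (2 <= n0)%N ->
  (forall n, (n0 <= n)%N -> image_seq n w =i image_seq n0 w) ->
  forall n, (n0 <= n)%N -> flow_image X t w = partition_image n w.
Proof.
move=> n02 stable n n0n; rewrite partition_imageE.
apply/seteqP; split=> v /=; last first.
  move=> /mapP[u un ->]; exists u => //=; rewrite in_itv/=.
  by apply: partition_itv un; exact: leq_trans n02 n0n.
move=> [u]; rewrite /= in_itv/= => /andP[u0 u1] <-.
rewrite stable//.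
(* The point 1 has no right neighbours in [0, 1], but it belongs to every partition. *)
have [u1'|u1'] := eqVneq u 1.
  by apply: map_f; rewrite u1' -(U_last n02) mem_nth// size_tuple prednK// (leq_trans _ n02).
have {u1'}u1 : u < 1 by rewrite lt_neqAle u1'.
apply: contrapT => /negP notin.
have [e e0 sep] := separated_from (image_seq n0 w) (X u t w).
have u01 : 0 <= u < 1 by rewrite u0.
have rc : X v t w @[v --> u^'+] --> X u t w.
  by have [_ _ H _ _] := flow; exact: (H u t w u01 (ltW t_gt0)).
have /cvgrPdist_lt/(_ e e0) := rc.
rewrite near_withinE => /nbhs_ballP[dl /= dl0 near_u].
have [N _ NU] : \forall m \near \oo,
    \big[Num.max/0]_(j < m.-1) (nth 0 (U m) j.+1 - nth 0 (U m) j) < dl.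
  have /cvgrPdist_lt/(_ dl dl0) := U_mesh.
  apply: filterS => m; rewrite sub0r normrN; exact/le_lt_trans/ler_norm.
pose m := maxn N n0.
have m2 : (2 <= m)%N by rewrite (leq_trans n02)// leq_maxr.
have := @mesh_point R (U m) u (u + dl) (U_sorted m2) (U_first m2).
rewrite size_tuple => /(_ (U_last m2) (leq_trans _ m2) u0 u1)[//||z [zm uz zv]].
  by rewrite addrC addKr; apply: NU; exact: leq_maxl.
have := near_u z; rewrite /= => /(_ _ uz) near_z.
have zin : X z t w \in image_seq n0 w.
  by rewrite -(stable m) ?leq_maxr//; exact: map_f.
have : e <= `|X z t w - X u t w|.
  by apply: sep => //; apply: contraNneq notin => <-.
rewrite leNgt distrC near_z//.
by rewrite /ball/= distrC gtr0_norm ?subr_gt0//; lra.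
Qed.

Definition changes n (w : Omega) : nat :=
  \sum_(j < n.-1) (X (nth 0%R (U n) j) t w != X (nth 0%R (U n) j.+1) t w).

Lemma size_image_seq n w : (2 <= n)%N ->
  (size (undup (image_seq n w)) <= (changes n w).+1)%N.
Proof.
move=> n2; apply: leq_trans (size_undup_changes 0 _) _.
rewrite ltnS size_map size_tuple /changes leq_eqVlt; apply/orP; left; apply/eqP.
apply: eq_bigr => j _; have jn := ltn_ord j.
have jn' : (j.+1 < size (U n))%N by rewrite size_tuple -ltn_predRL.
by rewrite !(nth_map 0)// ltnW.
Qed.

Let u n j := nth 0 (U n) j.

Let change_event n j : set Omega := [set w | X (u n j) t w <> X (u n j.+1) t w].

Let u01 n j : (2 <= n)%N -> (j < n)%N -> 0 <= u n j <= 1.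
Proof.
by move=> n2 jn; apply: (partition_itv n2); rewrite mem_nth// size_tuple.
Qed.

Let measurable_change_event n (j : 'I_n.-1) : (2 <= n)%N ->
  measurable (change_event n j).
Proof.
move=> n2; have jn : (j.+1 < n)%N by rewrite -ltn_predRL.
have mX i : (i < n)%N -> measurable_fun setT (X (u n i) t).
  by move=> ni; apply: (af_measurable flow); [exact: u01|exact: ltW].
rewrite (_ : change_event n j = ~` [set w | X (u n j) t w = X (u n j.+1) t w])//.
by apply: measurableC; apply: measurable_eq_set; apply: mX => //; exact: ltnW.
Qed.

Let changesE n w : ((changes n w)%:R)%:E =
  (\sum_(j < n.-1) (\1_(change_event n j) w)%:E)%E :> \bar R.
Proof.
rewrite sumEFin; congr (_ %:E); rewrite natr_sum; apply: eq_bigr => j _.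
rewrite indicE; congr (_%:R); congr nat_of_bool.
by apply/idP/idP => [/eqP H|/set_mem/eqP//]; exact/mem_set.
Qed.

Let measurable_change_indic n (j : 'I_n.-1) : (2 <= n)%N ->
  measurable_fun setT (fun w => (\1_(change_event n j) w)%:E : \bar R).
Proof.
by move=> n2; apply/measurable_EFinP/measurable_indic; exact: measurable_change_event.
Qed.

Lemma expected_changes : exists C : R, forall n, (2 <= n)%N ->
  (\int[P]_w ((changes n w)%:R)%:E <= C%:E)%E.
Proof.
pose c := normal_peak (Num.sqrt t).
have c0 : 0 <= c by exact: normal_peak_ge0.
(* The coefficient of [coalescence_bound]; the increments of the partition sum to 1. *)
exists (2 * c) => n n2.
have jn (j : 'I_n.-1) : (j.+1 < n)%N by rewrite -ltn_predRL.
under eq_integral do rewrite changesE.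
rewrite ge0_integral_sum//; last by move=> j; exact: measurable_change_indic.
apply: (@le_trans _ _ (\sum_(j < n.-1) (2 * c * (u n j.+1 - u n j))%:E)%E).
  apply: lee_sum => j _; rewrite integral_indic ?setIT//; last first.
    exact: measurable_change_event.
  have /andP[uj0 _] := u01 n2 (ltnW (jn j)); have /andP[_ uj1] := u01 n2 (jn j).
  have -> : 2 * c * (u n j.+1 - u n j) = 2 * (u n j.+1 - u n j) * c by ring.
  apply: (coalescence_bound flow) => //.
  rewrite /u lt_sorted_ltn_nth ?inE ?size_tuple ?U_sorted//; exact: ltnW.
rewrite sumEFin lee_fin -mulr_sumr.
have := telescope_nth (U n); rewrite size_tuple U_first// U_last// => ->.
by rewrite subr0 mulr1.
Qed.

(** Fatou turns the uniform bound of [expected_changes] into an almost surely finite lower limit of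
    [changes]. This bounds the number of distinct values along a subsequence, hence for all n
    because the images are nested. *)
Lemma flow_image_stable : {ae P, forall w, exists2 n0, (2 <= n0)%N &
  forall n, (n0 <= n)%N -> flow_image X t w = partition_image n w}.
Proof.
have [C EC] := expected_changes.
pose f n w : \bar R := ((changes n.+2 w)%:R)%:E.
have mf n : measurable_fun setT (f n).
  rewrite (_ : f n = fun w => \sum_(j < n.+1) (\1_(change_event n.+2 j) w)%:E)%E.
    apply: emeasurable_sum => j.
    exact: (@measurable_change_indic n.+2 j).
  by apply/funext => w; exact: changesE.
have f0 n w : (0 <= f n w)%E by rewrite lee_fin.
have fat := fatou P measurableT mf (fun n w _ => f0 n w).
have intC : (\int[P]_w (limn_einf (f ^~ w)) <= C%:E)%E.
  apply: le_trans fat _.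
  rewrite limn_einf_lim (cvg_lim _ (@cvg_einfs_sup R _))//.
  apply: ge_ereal_sup => _ [n _ <-].
  apply: (@le_trans _ _ (\int[P]_w f n w)%E); last exact: EC.
  by apply: ereal_inf_lbound; exists n => /=.
have : {ae P, forall w, setT w -> (limn_einf (f ^~ w)) \is a fin_num}.
  apply: integrable_ae => //; apply/integrableP; split.
    apply: (measurableT_comp (@oppe_measurable _ setT)).
    by apply: (@measurable_fun_limn_esup _ _ _ _ (fun n w => - f n w)%E) => n;
      exact: measurableT_comp.
  rewrite (eq_integral (fun w => limn_einf (f ^~ w))).
    by apply: le_lt_trans intC _; rewrite ltry.
  move=> w _; rewrite gee0_abs// limn_einf_lim (cvg_lim _ (@cvg_einfs_sup R _))//.
  apply: (@le_trans _ _ (einfs (f ^~ w) 0%N)); last first.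
    by apply: ereal_sup_ubound; exists 0%N.
  by apply: le_ereal_inf_tmp => _ [n /= _ <-]; exact: f0.
apply: filterS => w /(_ I) fin.
have [K HK] : exists K : R, forall n, exists2 m, (n <= m)%N & (f m w < K%:E)%E.
  by apply: limn_einf_lty; rewrite ltey_eq fin.
pose N n := size (undup (image_seq n.+2 w)).
have NK n : (N n <= (Num.bound K).+1)%N.
  have [m nm] := HK n; rewrite lte_fin => mK.
  have Nm : (N n <= (changes m.+2 w).+1)%N.
    apply: leq_trans (size_image_seq w (isT : (2 <= m.+2)%N)).
    apply: uniq_leq_size; first exact: undup_uniq.
    by move=> v; rewrite !mem_undup; apply: image_seq_subset.
  apply: leq_trans Nm _; rewrite ltnS -(ler_nat R); apply: ltW.
  apply: (lt_trans mK); apply: archi_boundP.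
  exact: (le_trans _ (ltW mK)).
(* A bounded sequence of naturals attains its maximum; beyond that index, nested images of equal
   cardinality coincide. *)
have [n0 maxN] : exists n0, forall n, (N n <= N n0)%N.
  have exN : exists m, `[< exists n, N n = m >] by exists (N 0%N); apply/asboolP; exists 0%N.
  have bd m : `[< exists n, N n = m >] -> (m <= (Num.bound K).+1)%N.
    by move=> /asboolP[n <-].
  have [m /asboolP[n0 Nn0] mmax] := ex_maxnP exN bd.
  by exists n0 => n; rewrite Nn0; apply: mmax; apply/asboolP; exists n.
exists n0.+2 => //; apply: flow_image_finite => // n n0n v.
have sub : {subset undup (image_seq n0.+2 w) <= undup (image_seq n w)}.
  by move=> x; rewrite !mem_undup; apply: image_seq_subset.
have [n' nE] : exists n', n = n'.+2 by case: n n0n {sub} => [//|[//|n']] _; exists n'.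
have := uniq_min_size (undup_uniq _) sub.
rewrite nE => /(_ (maxN n')) [_ /(_ v)].
by rewrite !mem_undup => ->.
Qed.

End FiniteImage.

(** * Sums over distinct tuples *)

Section DistinctTuples.
Context {R : realType} (n k : nat).
Implicit Types (v : 'I_n -> R) (sigma : k.-tuple 'I_n).

(* Each value of [v] is represented by the least index at which it occurs. *)
Definition first_occurrence v (i : 'I_n) : bool :=
  [forall j : 'I_n, (j < i)%N ==> (v j != v i)].

Definition representative v sigma : bool :=
  uniq sigma && all (first_occurrence v) sigma.

Lemma first_occurrence_inj v i j :
  first_occurrence v i -> first_occurrence v j -> v i = v j -> i = j.
Proof.
move=> /forallP fi /forallP fj vij; apply: val_inj => /=.
case: (ltngtP i j) => // ij.
  by have := fj i; rewrite ij vij eqxx.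
by have := fi j; rewrite ij vij eqxx.
Qed.

Lemma first_occurrence_exists v i :
  exists j, first_occurrence v j /\ v j = v i.
Proof.
have [j vj jmin] := @arg_minnP _ i (fun j => v j == v i) (fun j => val j) (eqxx _).
exists j; split; last exact/eqP.
apply/forallP => l; apply/implyP => lj; apply/negP => /eqP vlj.
have := jmin l; rewrite vlj vj => /(_ isT).
by rewrite leqNgt lj.
Qed.

Lemma esum_finType (T : finType) (Q : pred T) (a : T -> \bar R) :
  (forall x, 0 <= a x)%E ->
  \esum_(x in [set x | Q x]) a x = (\sum_(x | Q x) a x)%E.
Proof.
move=> a0; rewrite (_ : [set x | Q x] = [set` enum Q]); last first.
  by apply/seteqP; split=> x /=; rewrite mem_enum.
by rewrite esum_fset// -fsbig_seq ?enum_uniq// big_enum.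
Qed.

(** Indexing distinct tuples of values by tuples of least indices replaces a sum over a random set
    by one over a fixed finite type, with terms measurable in the randomness. *)
Lemma representative_bij v : set_bij [set sigma | representative v sigma]
  (@distinct_tuples R k (range v)) (map_tuple v).
Proof.
split.
- move=> sigma /andP[us /allP fs]; split.
    rewrite map_inj_in_uniq// => i j /fs fi /fs fj; exact: first_occurrence_inj.
  by move=> i; rewrite tnth_map; exists (tnth sigma i).
- move=> s s' /set_mem/andP[_ /allP fs] /set_mem/andP[_ /allP fs'] ss'.
  apply: eq_from_tnth => i.
  apply: (@first_occurrence_inj v); [exact/fs/mem_tnth|exact/fs'/mem_tnth|].
  by have := congr1 (fun z => tnth z i) ss'; rewrite !tnth_map.
move=> y [uy Sy].
have /fin_all_exists[f Pf] : forall i : 'I_k, exists j, first_occurrence v j /\ v j = tnth y i.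
  by move=> i; have [j _ <-] := Sy i; exact: first_occurrence_exists.
exists [tuple f i | i < k]; last first.
  by apply: eq_from_tnth => i; rewrite tnth_map tnth_mktuple; have [] := Pf i.
apply/andP; split; last first.
  by apply/allP => j /mapP[i _ ->]; have [] := Pf i.
rewrite map_inj_uniq ?enum_uniq// => i j fij.
apply/eqP; rewrite -val_eqE/= -(nth_uniq 0 _ _ uy) ?size_tuple//.
rewrite -!tnth_nth; apply/eqP.
by have [_ <-] := Pf i; have [_ <-] := Pf j; rewrite fij.
Qed.

Lemma esum_distinct_tuples v (g : k.-tuple R -> \bar R) :
  (forall y, 0 <= g y)%E ->
  \esum_(y in @distinct_tuples R k (range v)) g y =
  (\sum_(sigma | representative v sigma) g (map_tuple v sigma))%E.
Proof.
move=> g0; rewrite (@reindex_esum _ _ _ [set sigma | representative v sigma]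
  _ (map_tuple v) g (@representative_bij v)).
by rewrite esum_finType// => sigma; exact: g0.
Qed.

Context {d} {Omega : measurableType d} (Y : 'I_n -> Omega -> R).
Hypothesis mY : forall i, measurable_fun setT (Y i).

Lemma measurable_representative sigma :
  measurable [set w | representative (Y ^~ w) sigma].
Proof.
have mfst i : measurable [set w | first_occurrence (Y ^~ w) i].
  rewrite (_ : mkset _ = \bigcap_(j in [set j : 'I_n | (j < i)%N])
     ~` [set w | Y j w = Y i w]).
    apply: fin_bigcap_measurable; first exact: finite_finset.
    by move=> j _; apply: measurableC; exact: measurable_eq_set.
  apply/seteqP; split=> w /=.
    by move=> /forallP H j ji; have := H j; rewrite ji => /eqP.
  by move=> H; apply/forallP => j; apply/implyP => ji; apply/eqP; exact: H.
have [us|us] := boolP (uniq sigma); last first.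
  rewrite (_ : mkset _ = set0)//; apply/seteqP; split=> w //=.
  by rewrite /representative (negbTE us).
rewrite (_ : mkset _ = \bigcap_(i in [set i : 'I_n | i \in sigma])
   [set w | first_occurrence (Y ^~ w) i]).
  by apply: fin_bigcap_measurable => //; exact: finite_finset.
apply/seteqP; split=> w /=; rewrite /representative us/=.
  by move=> /allP H i /H.
by move=> H; apply/allP => i /H.
Qed.

Lemma measurable_map_tuple sigma :
  measurable_fun setT (fun w => map_tuple (Y ^~ w) sigma).
Proof.
apply/measurable_fun_tnthP => i.
rewrite (_ : _ \o _ = Y (tnth sigma i))//.
by apply/funext => w /=; rewrite tnth_map.
Qed.

Lemma measurable_esum_distinct_tuples (f : k.-tuple R -> R) :
  measurable_fun setT f -> (forall y, 0 <= f y) ->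
  measurable_fun setT (fun w =>
    \esum_(y in @distinct_tuples R k (range (Y ^~ w))) (f y)%:E).
Proof.
move=> mf f0.
rewrite (_ : (fun w => _) = fun w => \sum_sigma
   ((\1_[set w | representative (Y ^~ w) sigma] w)%:E *
    (f (map_tuple (Y ^~ w) sigma))%:E)%E)%E.
  apply: emeasurable_sum => sigma; apply: emeasurable_funM.
    by apply/measurable_EFinP/measurable_indic; exact: measurable_representative.
  apply/measurable_EFinP; apply: measurableT_comp => //.
  exact: measurable_map_tuple.
apply/funext => w; rewrite esum_distinct_tuples; last by move=> y; rewrite lee_fin.
rewrite big_mkcond/=; apply: eq_bigr => sigma _; rewrite indicE.
case: ifPn => [H|H]; first by rewrite mem_set// mul1e.
by rewrite memNset ?mul0e//=; exact/negP.
Qed.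

End DistinctTuples.

Lemma esum_subset (R : realType) (T : choiceType) (I J : set T)
    (a : T -> \bar R) : I `<=` J ->
  (\esum_(i in I) a i <= \esum_(i in J) a i)%E.
Proof.
move=> IJ; apply: le_ereal_sup => _ [A [finA AI] <-].
by exists A => //; split=> //; exact: subset_trans AI IJ.
Qed.

Lemma distinct_tuples_subset (R : realType) (k : nat) (S S' : set R) :
  S `<=` S' -> @distinct_tuples R k S `<=` distinct_tuples S'.
Proof. by move=> SS' y [uy Sy]; split=> // i; exact/SS'. Qed.

(** * Coalescence schemes *)

Section Schemes.
Context {R : realType}.
Implicit Types (ys : seq (R -> R)) (f : R -> R) (t : R).

Lemma first_zero f : {within `[0, +oo[, continuous f} ->
  (exists2 s, 0 <= s & f s = 0) ->
  exists r, [/\ 0 <= r, f r = 0 & forall s, 0 <= s -> f s = 0 -> r <= s].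
Proof.
move=> cf [s0 s00 fs0].
pose Z := [set s | 0 <= s /\ f s = 0].
have Z_lb : lbound Z 0 by move=> s [].
have hZ : has_inf Z by split; [exists s0|exists 0].
have r0 : 0 <= inf Z by apply: lb_le_inf => //; exists s0.
have rlb s : 0 <= s -> f s = 0 -> inf Z <= s.
  by move=> s0' fs; apply: ge_inf; [exists 0|].
exists (inf Z); split => //; apply: contrapT => /eqP fr.
have fr0 : 0 < `|f (inf Z)| by rewrite normr_gt0.
have rI : [set` `[0, +oo[] (inf Z) by rewrite /= in_itv/= r0.
have [dl dl0 H] := within_continuous_dist cf rI fr0.
have [s [s1 fs] ss] := inf_adherent dl0 hZ.
have sI : [set` `[0, +oo[] s by rewrite /= in_itv/= s1.
suff /(H _ sI) : `|inf Z - s| < dl by rewrite fs subr0 ltxx.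
have rs := rlb _ s1 fs.
by rewrite distrC ger0_norm ?subr_ge0//; move: rs ss; clear; lra.
Qed.

Local Notation path_at ys i := (nth (fun=> 0) ys i).

Definition continuous_paths ys :=
  forall i, {within `[0, +oo[, continuous (path_at ys i)}.

Definition first_collision ys (i : nat) (r : R) : Prop :=
  [/\ 0 <= r, in_collision ys r i &
   forall s a, 0 <= s -> in_collision ys s a -> r <= s].

Lemma collision_time_first ys i r :
  first_collision ys i r -> collision_time ys = r.
Proof.
move=> [r0 ri rmin]; apply/le_anti/andP; split.
  by apply: ge_inf; [exists 0 => s []|split => //; exists i].
apply: lb_le_inf; first by exists r; split => //; exists i.
by move=> s [s0 [a sa]]; exact: rmin sa.
Qed.

Lemma in_collision_timeP ys i :
  in_collision ys (collision_time ys) i <-> exists r, first_collision ys i r.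
Proof.
split=> [ic|[r fc]]; last first.
  by rewrite (collision_time_first fc); case: fc.
exists (collision_time ys); split => //.
  rewrite /collision_time; set C := mkset _.
  (* Without any collision [collision_time] is the infimum of the empty set, which is 0. *)
  have [->|/set0P C0] := eqVneq C set0; first by rewrite inf0.
  by apply: lb_le_inf => // s [].
move=> s a s0 sa; apply: ge_inf; first by exists 0 => z [].
by split => //; exists a.
Qed.

(** There are finitely many pairs of paths; among those that ever meet, take one whose first meeting
    time, given by [first_zero], is least. *)
Lemma first_collision_exists ys : continuous_paths ys ->
  (exists s i, 0 <= s /\ in_collision ys s i) ->
  exists i r, first_collision ys i r.
Proof.
move=> cys [s [i [s0 [iy [j [jy ji ijs]]]]]].
pose n := size ys; pose ij : 'I_n * 'I_n := (Ordinal iy, Ordinal jy).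
pose f (z : 'I_n * 'I_n) r := path_at ys z.1 r - path_at ys z.2 r.
have cf z : {within `[0, +oo[, continuous (f z)}.
  by move=> r; apply: cvgB; exact: cys.
pose Q (z : 'I_n * 'I_n) := (z.1 != z.2) && `[< exists2 s, 0 <= s & f z s = 0 >].
have /choice[g Pg] z : exists r, Q z ->
    [/\ 0 <= r, f z r = 0 & forall s, 0 <= s -> f z s = 0 -> r <= s].
  have [/andP[_ /asboolP zz]|nQ] := boolP (Q z); last by exists 0.
  by have [r Hr] := first_zero (@cf z) zz; exists r.
have Qij : Q ij.
  apply/andP; split; first by rewrite eq_sym -val_eqE.
  by apply/asboolP; exists s => //; rewrite /f /= ijs subrr.
have [z Qz zmin] := @arg_minP _ _ _ ij Q g Qij.
have [g0 fg _] := Pg z Qz.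
exists z.1, (g z); split => //.
  split; first exact: ltn_ord.
  exists z.2; split; first exact: ltn_ord.
    by case/andP: Qz => + _; rewrite eq_sym.
  by apply/eqP; rewrite eq_sym -subr_eq0; apply/eqP.
move=> r a r0 [an [b [bn ba rab]]].
pose ab : 'I_n * 'I_n := (Ordinal an, Ordinal bn).
have fab : f ab r = 0 by rewrite /f/= rab subrr.
have Qab : Q ab.
  apply/andP; split; first by rewrite eq_sym -val_eqE.
  by apply/asboolP; exists r.
by apply: le_trans (zmin ab Qab) _; have [_ _] := Pg ab Qab; exact.
Qed.

(** The least index in collision has a partner, which is in collision too and therefore has a larger
    index. This is why the i-th entry of a scheme is at most n - i. *)
Lemma collision_index_lt ys : (exists i r, first_collision ys i r) ->
  (collision_index ys < (size ys).-1)%N.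
Proof.
move=> [i [r fc]].
pose p i := `[< in_collision ys (collision_time ys) i >].
have hasp : has p (iota 0 (size ys)).
  apply/hasP; exists i; last by apply/asboolP/in_collision_timeP; exists r.
  by rewrite mem_iota/= add0n; case: fc => _ [].
have fs : (collision_index ys < size ys)%N.
  by rewrite -[X in (_ < X)%N](size_iota 0) -has_find.
have /asboolP[_ [j [js jc eqj]]] : p (collision_index ys).
  by have := nth_find 0%N hasp; rewrite nth_iota.
have pj : p j.
  apply/asboolP; split => //; exists (collision_index ys); split => //.
  by rewrite eq_sym.
have cj : (collision_index ys <= j)%N.
  rewrite leqNgt; apply/negP => jc'; have := before_find 0%N jc'.
  by rewrite nth_iota// add0n => /negP; apply; exact: pj.
have {}cj : (collision_index ys < j)%N by rewrite ltn_neqAle eq_sym jc.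
by rewrite ltn_predRL; exact: leq_ltn_trans js.
Qed.

Definition delete (T : Type) (j : nat) (s : seq T) := take j s ++ drop j.+1 s.

Lemma size_delete (T : Type) j (s : seq T) : (j < size s)%N ->
  size (delete j s) = (size s).-1.
Proof.
move=> js; rewrite size_cat size_takel ?size_drop 1?ltnW//; lia.
Qed.

Lemma nth_delete (T : Type) (x0 : T) j (s : seq T) i :
  exists i', nth x0 (delete j s) i = nth x0 s i'.
Proof.
rewrite nth_cat; case: ltnP => [ij|_]; last by eexists; rewrite nth_drop.
exists i; rewrite nth_take//; apply: leq_trans ij _.
by rewrite size_take; case: ltnP.
Qed.

Lemma mem_delete (T : eqType) j (s : seq T) : {subset delete j s <= s}.
Proof. by move=> x; rewrite mem_cat => /orP[/mem_take|/mem_drop]. Qed.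

Lemma map_delete (T T' : Type) (g : T -> T') j (s : seq T) :
  map g (delete j s) = delete j (map g s).
Proof. by rewrite map_cat map_take map_drop. Qed.

(** The size condition forces two remaining paths to agree at time [t], so a collision exists. It
    survives a deletion, which lowers [r] and the number of paths by one and does not increase the
    number of values. *)
Lemma collision_scheme_mem t r ys : 0 <= t -> continuous_paths ys ->
  (size (undup [seq y t | y <- ys]) + r <= size ys)%N ->
  collision_scheme r ys \in schemes (size ys) r.
Proof.
move=> t0; elim: r ys => [//|r IH] ys cys hr /=.
have [i [j [ij jn eqij]]] : exists i j, [/\ (i < j)%N, (j < size ys)%N &
    path_at ys i t = path_at ys j t].
  have : ~~ uniq [seq y t | y <- ys].
    by rewrite -ltn_size_undup size_map; move: hr; lia.
  move=> /(uniqPn 0)[i [j [ij]]]; rewrite size_map => jn.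
  by rewrite !(nth_map (fun=> 0)) ?(ltn_trans ij)// => e; exists i, j.
have fc : exists i r, first_collision ys i r.
  apply: first_collision_exists => //; exists t, i; split => //.
  split; first exact: ltn_trans jn.
  by exists j; split => //; rewrite gtn_eqF.
have cl := collision_index_lt fc.
have cs : (collision_index ys < size ys)%N by apply: leq_trans cl (leq_pred _).
apply: allpairs_f.
  by rewrite mem_iota; lia.
rewrite -/(delete _ _) -(size_delete cs); apply: IH.
  by move=> l; have [l' ->] := nth_delete (fun=> 0) (collision_index ys) ys l; exact: cys.
rewrite size_delete//; move: hr; rewrite map_delete.
have : (size (undup (delete (collision_index ys) [seq y t | y <- ys])) <=
   size (undup [seq y t | y <- ys]))%N.
  apply: uniq_leq_size; first exact: undup_uniq.
  by move=> x; rewrite !mem_undup; exact: mem_delete.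
by lia.
Qed.

Lemma coalescence_scheme_mem t ys : 0 <= t -> continuous_paths ys ->
  coalescence_scheme t ys \in
    schemes (size ys) (size ys - size (undup [seq y t | y <- ys])).
Proof.
move=> t0 cys; apply: (collision_scheme_mem t0) => //.
rewrite subnKC// -[X in (_ <= X)%N](size_map (fun y => y t)); exact: size_undup.
Qed.

Lemma schemes_uniq n r : uniq (schemes n r).
Proof.
elim: r n => [//|r IH] n /=; apply: allpairs_uniq; rewrite ?iota_uniq//.
by move=> [a b] [c e] _ _ /= [-> ->].
Qed.

Lemma size_schemes n r J : J \in schemes n r -> size J = r.
Proof.
elim: r n J => [|r IH] n J /=; first by rewrite inE => /eqP ->.
by move=> /allpairsP[[a b] /= [_ /IH <- ->]].
Qed.

End Schemes.

(** * Measurability of the coalescence scheme *)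

Section MeasurableSchemes.
Context {R : realType} {d} {Omega : measurableType d}.
Context (X : R -> R -> Omega -> R).
Hypothesis mX : forall u s : R, 0 <= u <= 1 -> 0 <= s ->
  measurable_fun setT (X u s).
Hypothesis cX : forall (u : R) w, 0 <= u <= 1 ->
  {within `[0, +oo[, continuous (fun s => X u s w)}.
Implicit Types (x : seq R).

Local Notation path_at ys i := (nth (fun=> 0) ys i).

Lemma trajectories_nth x w i : (i < size x)%N ->
  path_at (trajectories X x w) i = (fun s => X (nth 0 x i) s w).
Proof. by move=> ix; rewrite (nth_map 0). Qed.

Lemma size_trajectories x w : size (trajectories X x w) = size x.
Proof. exact: size_map. Qed.

Lemma continuous_trajectories x w : {in x, forall u, 0 <= u <= 1} ->
  continuous_paths (trajectories X x w).
Proof.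
move=> x01 i; have [ix|ix] := ltnP i (size x).
  by rewrite trajectories_nth//; apply: cX; apply: x01; exact: mem_nth.
rewrite nth_default ?size_trajectories// => r; exact: cvg_cst.
Qed.

Let q (m n : nat) : R := m%:R / n.+1%:R.

Let q_ge0 m n : 0 <= q m n.
Proof. exact: divr_ge0. Qed.

Let q_dense (a b : R) : 0 <= a -> a < b -> exists m n, a <= q m n < b.
Proof.
move=> a0 ab; have ba : 0 < b - a by rewrite subr_gt0.
pose n := Num.bound ((b - a)^-1).
have an : 0 <= a * n.+1%:R by rewrite mulr_ge0.
have /andP[m1 m2] := truncn_itv an.
have nb : n.+1%:R^-1 < b - a.
  rewrite invf_plt ?posrE//; apply: (@lt_trans _ _ n%:R); last by rewrite ltr_nat.
  by apply: archi_boundP; rewrite invr_ge0 ltW.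
exists (Num.truncn (a * n.+1%:R)).+1, n; rewrite /q ler_pdivlMr// (ltW m2)/=.
rewrite -natr1 mulrDl mul1r.
have : (Num.truncn (a * n.+1%:R))%:R / n.+1%:R <= a by rewrite ler_pdivrMr.
by move: nb; set z := n.+1%:R^-1; set y := _ * z; lra.
Qed.

Let meet x i j s := meeting (X (nth 0 x i)) (X (nth 0 x j)) s.

(* Particles [i] and [j] meet, and no pair meets before them: it suffices to
   compare the meetings by the rational times [q m n]. *)
Let first_pair x i j : set Omega :=
  (\bigcup_N meet x i j N%:R) `&`
  \bigcap_(a in [set a | (a < size x)%N])
   \bigcap_(b in [set b | (b < size x)%N && (b != a)])
    \bigcap_m \bigcap_n (~` meet x a b (q m n) `|` meet x i j (q m n)).

Let measurable_meet x i j s : {in x, forall u, 0 <= u <= 1} ->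
  (i < size x)%N -> (j < size x)%N -> 0 <= s -> measurable (meet x i j s).
Proof.
move=> x01 ix jx s0.
have xn l : (l < size x)%N -> 0 <= nth 0 x l <= 1.
  by move=> lx; apply: x01; exact: mem_nth.
apply: measurable_meeting => //.
- by move=> r r0; apply: mX => //; exact: xn.
- by move=> r r0; apply: mX => //; exact: xn.
- by move=> w; apply: cX; exact: xn.
- by move=> w; apply: cX; exact: xn.
Qed.

Let measurable_first_pair x i j : {in x, forall u, 0 <= u <= 1} ->
  (i < size x)%N -> (j < size x)%N -> measurable (first_pair x i j).
Proof.
move=> x01 ix jx; apply: measurableI.
  by apply: bigcupT_measurable => N; exact: measurable_meet.
apply: bigcap_measurable; first by exists i.
move=> a /= ax.
have [[b bx]|nb] := pselect (exists b, (b < size x)%N && (b != a)); last first.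
  rewrite (_ : mkset _ = set0) ?bigcap_set0//.
  by apply/seteqP; split=> // b bx; apply: nb; exists b.
apply: bigcap_measurable; first by exists b.
move=> {bx}b /andP[bx _].
apply: bigcapT_measurable => m; apply: bigcapT_measurable => n.
by apply: measurableU; [apply: measurableC|]; exact: measurable_meet.
Qed.

Let first_pairP x i j w : {in x, forall u, 0 <= u <= 1} ->
  (i < size x)%N -> (j < size x)%N ->
  first_pair x i j w <-> exists r, [/\ 0 <= r,
    X (nth 0 x i) r w = X (nth 0 x j) r w &
    forall s a, 0 <= s -> in_collision (trajectories X x w) s a -> r <= s].
Proof.
move=> x01 ix jx; split=> [[[N _ [r [r0 _ rij]]] H]|[r [r0 rij rmin]]].
  have xn l : (l < size x)%N -> 0 <= nth 0 x l <= 1.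
    by move=> lx; apply: x01; exact: mem_nth.
  pose f s := X (nth 0 x i) s w - X (nth 0 x j) s w.
  have cf : {within `[0, +oo[, continuous f}.
    by move=> s; apply: cvgB; apply: cX; exact: xn.
  have [|r1 [r10 fr1 r1min]] := first_zero cf.
    by exists r => //; rewrite /f rij subrr.
  exists r1; split => //; first by apply/eqP; rewrite -subr_eq0; apply/eqP.
  move=> s a s0 [ax [b [bx ba sab]]]; rewrite leNgt; apply/negP => sr.
  (* A collision strictly before [r1] leaves room for a rational time in between; by that time [i]
     and [j] would have met, against the minimality of [r1]. *)
  have [m [n /andP[sq qr]]] := q_dense s0 sr.
  rewrite size_trajectories in ax; rewrite size_trajectories in bx.
  rewrite !trajectories_nth// in sab.
  have bxa : (b < size x)%N && (b != a) by rewrite bx.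
  have [] := H a ax b bxa m I n I; first by apply; exists s.
  move=> [r2 [r20 r2q r2ij]].
  have := r1min r2 r20; rewrite /f r2ij subrr => /(_ erefl).
  by rewrite leNgt (le_lt_trans r2q).
split.
  exists (Num.bound r) => //; exists r; split => //; exact/ltW/archi_boundP.
move=> a ax b /andP[bx ba] m _ n _ /=.
apply: contrapT => /not_orP[/contrapT[s [s0 sq sab]] nij]; apply: nij.
exists r; split => //; apply: le_trans sq; apply: (rmin s a) => //.
rewrite /in_collision size_trajectories; split => //; exists b; split => //.
by rewrite !trajectories_nth.
Qed.

Let collides x i : set Omega := [set w |
  in_collision (trajectories X x w) (collision_time (trajectories X x w)) i].

Let measurable_collides x i : {in x, forall u, 0 <= u <= 1} ->
  measurable (collides x i).
Proof.
move=> x01; have [ix|ix] := ltnP i (size x); last first.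
  rewrite (_ : collides x i = set0)//; apply/seteqP; split=> // w [iw _].
  by rewrite size_trajectories ltnNge ix in iw.
rewrite (_ : collides x i =
    \bigcup_(j in [set j | (j < size x)%N && (j != i)]) first_pair x i j).
  by apply: bigcup_measurable => j /andP[jx _]; exact: measurable_first_pair.
apply/seteqP; split=> w.
  move=> /in_collision_timeP[r [r0 [_ [j [jx ji rij]]] rmin]].
  rewrite size_trajectories in jx; rewrite !trajectories_nth// in rij.
  exists j; first by rewrite /= jx.
  by apply/first_pairP => //; exists r.
move=> [j /= /andP[jx ji] /first_pairP[]// r [r0 rij rmin]].
apply/in_collision_timeP; exists r; split => //.
rewrite /in_collision size_trajectories; split => //; exists j; split => //.
by rewrite !trajectories_nth.
Qed.

Lemma measurable_find (E : nat -> set Omega) (s : seq nat) (j : nat) :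
  (forall i, measurable (E i)) ->
  measurable [set w | find (fun i => `[< E i w >]) s = j].
Proof.
move=> mE; elim: s j => [|a s IH] j /=.
  by have [->|j0] := eqVneq j 0%N; [rewrite (_ : mkset _ = setT)|rewrite (_ : mkset _ = set0)];
    rewrite //; apply/seteqP; split=> w //= j0'; move: j0; rewrite j0' eqxx.
case: j => [|j].
  rewrite (_ : mkset _ = E a)//; apply/seteqP; split=> w /=.
    by case: asboolP.
  by move=> Ea; rewrite asboolT.
rewrite (_ : mkset _ = ~` E a `&` [set w | find (fun i => `[< E i w >]) s = j]).
  by apply: measurableI => //; exact: measurableC.
apply/seteqP; split=> w /=; first by case: asboolP => // nE [].
by move=> [nE <-]; rewrite asboolF.
Qed.

Lemma measurable_collision_index x j : {in x, forall u, 0 <= u <= 1} ->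
  measurable [set w | collision_index (trajectories X x w) = j].
Proof.
move=> x01; rewrite (_ : mkset _ =
   [set w | find (fun i => `[< collides x i w >]) (iota 0 (size x)) = j]).
  by apply: measurable_find => i; exact: measurable_collides.
by apply/seteqP; split=> w /=; rewrite /collision_index size_trajectories.
Qed.

(** Once the first entry [a] is fixed, the deleted start point is deterministic, at index [a.-1]
    since schemes count from 1. The rest is a scheme for a fixed shorter list. *)
Lemma measurable_collision_scheme x r J : {in x, forall u, 0 <= u <= 1} ->
  measurable [set w | collision_scheme r (trajectories X x w) = J].
Proof.
elim: r x J => [|r IH] x J x01 /=.
  by case: J => [|a J]; [rewrite (_ : mkset _ = setT)|rewrite (_ : mkset _ = set0)];
    rewrite //; apply/seteqP; split.
case: J => [|a J].
  by rewrite (_ : mkset _ = set0)//; apply/seteqP; split.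
rewrite (_ : mkset _ = [set w | (collision_index (trajectories X x w)).+1 = a] `&`
   [set w | collision_scheme r (trajectories X (delete a.-1 x) w) = J]).
  apply: measurableI.
    case: a => [|a]; first by rewrite (_ : mkset _ = set0)//; apply/seteqP; split.
    rewrite (_ : mkset _ = [set w | collision_index (trajectories X x w) = a]).
      exact: measurable_collision_index.
    by apply/seteqP; split=> w /=; [case|move=> ->].
  by apply: IH => u /mem_delete; exact: x01.
apply/seteqP; split=> w /=.
  by move=> [<- <-]; split => //; rewrite /= /trajectories map_delete.
by move=> [<- <-]; rewrite /= /trajectories map_delete.
Qed.

Lemma measurable_mem_values t x u : 0 <= t -> {in x, forall v, 0 <= v <= 1} ->
  0 <= u <= 1 -> measurable [set w | X u t w \in [seq X v t w | v <- x]].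
Proof.
move=> t0; elim: x => [|v x IH] x01 u01 /=.
  by rewrite (_ : mkset _ = set0)//; apply/seteqP; split.
rewrite (_ : mkset _ = [set w | X u t w = X v t w] `|`
   [set w | X u t w \in [seq X v t w | v <- x]]).
  apply: measurableU.
    by apply: measurable_eq_set; apply: mX => //; apply: x01; rewrite in_cons eqxx.
  by apply: IH => // v' v'x; apply: x01; rewrite in_cons v'x orbT.
apply/seteqP; split=> w /=; rewrite in_cons.
  by move=> /orP[/eqP|]; [left|right].
by move=> [->|->]; rewrite ?eqxx ?orbT.
Qed.

Lemma measurable_size_values t x l : 0 <= t -> {in x, forall v, 0 <= v <= 1} ->
  measurable [set w | size (undup [seq X v t w | v <- x]) = l].
Proof.
move=> t0; elim: x l => [|v x IH] l x01 /=.
  by case: l => [|l]; [rewrite (_ : mkset _ = setT)|rewrite (_ : mkset _ = set0)];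
    rewrite //; apply/seteqP; split.
have x01' : {in x, forall v, 0 <= v <= 1}.
  by move=> u ux; apply: x01; rewrite in_cons ux orbT.
have v01 : 0 <= v <= 1 by apply: x01; rewrite in_cons eqxx.
have mv := measurable_mem_values t0 x01' v01.
rewrite (_ : mkset _ =
  ([set w | X v t w \in [seq X v t w | v <- x]] `&`
   [set w | size (undup [seq X v t w | v <- x]) = l]) `|`
  (~` [set w | X v t w \in [seq X v t w | v <- x]] `&`
   [set w | (size (undup [seq X v t w | v <- x])).+1 = l])).
  apply: measurableU; first by apply: measurableI => //; exact: IH.
  apply: measurableI; first exact: measurableC.
  case: l => [|l]; first by rewrite (_ : mkset _ = set0)//; apply/seteqP; split.
  rewrite (_ : mkset _ = [set w | size (undup [seq X v t w | v <- x]) = l]).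
    exact: IH.
  by apply/seteqP; split=> w /=; [case|move=> ->].
apply/seteqP; split=> w /=; case: ifP => vx.
- by left.
- by right; split => //; rewrite vx.
- by case=> [[]//|[]].
- by case=> [[]//|[]].
Qed.

Lemma measurable_coalescence_scheme t x J : 0 <= t ->
  {in x, forall v, 0 <= v <= 1} ->
  measurable [set w | coalescence_scheme t (trajectories X x w) = J].
Proof.
move=> t0 x01; rewrite (_ : mkset _ =
  \bigcup_l ([set w | size (undup [seq X v t w | v <- x]) = l] `&`
    [set w | collision_scheme (size x - l) (trajectories X x w) = J])).
  apply: bigcupT_measurable => l; apply: measurableI.
    exact: measurable_size_values.
  exact: measurable_collision_scheme.
have E w : [seq y t | y <- trajectories X x w] = [seq X v t w | v <- x].
  by rewrite -map_comp.
apply/seteqP; split=> w /=; rewrite /coalescence_scheme size_trajectories E.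
  by move=> H; exists (size (undup [seq X v t w | v <- x])).
by move=> [l _ [<-]].
Qed.

End MeasurableSchemes.

(** * Comparison of densities *)

Section DensityComparison.
Context {R : realType} {d} {T : measurableType d}.
Context (mu : {sigma_finite_measure set T -> \bar R}).
Local Open Scope ereal_scope.
Implicit Types (p q : T -> R) (A E : set T).

Let mul_indic_measurable p A : measurable_fun setT p -> measurable A ->
  measurable_fun setT (fun y => (\1_A y * p y)%:E).
Proof.
move=> mp mA; apply/measurable_EFinP; apply: measurable_funM => //.
Qed.

Lemma ae_ge0_of_integral p : measurable_fun setT p ->
  (forall A, measurable A -> 0 <= \int[mu]_y (\1_A y * p y)%:E) ->
  {ae mu, forall y, (0 <= p y)%R}.
Proof.
move=> mp H; pose A := [set y | (p y < 0)%R].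
have mA : measurable A by apply: measurable_lt_set.
have g0 y : 0 <= (\1_A y * - p y)%:E.
  rewrite lee_fin indicE; have [/set_mem/= py|] := boolP (y \in A).
    by rewrite mul1r oppr_ge0 ltW.
  by rewrite mul0r.
have mg : measurable_fun setT (fun y => (\1_A y * - p y)%:E).
  by apply: (@mul_indic_measurable (fun y => - p y)%R) => //; exact: measurableT_comp.
have := H A mA; under eq_integral do rewrite -[p _]opprK mulrN EFinN.
rewrite integral_ge0N// oppe_ge0 => I0.
have {}I0 : \int[mu]_y `|(\1_A y * - p y)%:E| = 0.
  rewrite (eq_integral (fun y => (\1_A y * - p y)%:E)).
    by apply/le_anti; rewrite I0 integral_ge0.
  by move=> y _; rewrite gee0_abs.
have := (ae_eq_integral_abs mu measurableT mg).1 I0.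
apply: filterS => y /(_ I); rewrite indicE leNgt => /= yp.
apply/negP => py; move: yp; rewrite mem_set// mul1r => /eqP.
by rewrite eqe oppr_eq0 lt_eqF.
Qed.

(** The integrals may be infinite, so the set where q < p is exhausted by the sets [B m], of finite
    measure and with both functions bounded. There the difference is integrable and positive with
    integral at most 0. *)
Lemma ae_le_of_integral p q E : measurable_fun setT p -> measurable_fun setT q ->
  measurable E ->
  (forall A, measurable A -> A `<=` E ->
    \int[mu]_y (\1_A y * p y)%:E <= \int[mu]_y (\1_A y * q y)%:E) ->
  {ae mu, forall y, E y -> (p y <= q y)%R}.
Proof.
move=> mp mq mE H.
have /sigma_finiteP[F [TF ndF Foo]] := sigma_finiteT mu.
pose B m := E `&` [set y | (q y < p y)%R] `&`
  ([set y | (`|p y| <= m%:R)%R] `&` [set y | (`|q y| <= m%:R)%R]) `&` F m.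
have mle (f : T -> R) (c : R) : measurable_fun setT f -> measurable [set y | (`|f y| <= c)%R].
  move=> mf; rewrite (_ : mkset _ = ~` [set y | (c < `|f y|)%R]).
    by apply: measurableC; apply: measurable_lt_set => //; exact: measurableT_comp.
  by apply/seteqP; split=> y /=; rewrite leNgt => /negP.
have mB m : measurable (B m).
  apply: measurableI; last by have [] := Foo m.
  by apply: measurableI; apply: measurableI => //; try exact: mle; exact: measurable_lt_set.
have muB m : mu (B m) = 0.
  have Boo : mu (B m) < +oo.
    apply: le_lt_trans (Foo m).2; apply: le_measure; rewrite ?inE//.
      by have [] := Foo m.
    by move=> y [].
  have bounded (f : T -> R) : measurable_fun setT f ->
      (forall y, B m y -> (`|f y| <= m%:R)%R) ->
      mu.-integrable setT (fun y => (\1_(B m) y * f y)%:E).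
    move=> mf fB; apply: (@le_integrable _ _ _ mu setT measurableT _
        (fun y => (m%:R * \1_(B m) y)%:E)).
    - exact: mul_indic_measurable.
    - move=> y _; rewrite !abse_EFin lee_fin indicE.
      have [/set_mem By|] := boolP (y \in B m); last by rewrite mul0r mulr0.
      by rewrite mul1r mulr1 [leRHS]ger0_norm// fB.
    - apply: (@integrableZl _ _ _ mu setT measurableT m%:R (fun y => (\1_(B m) y)%:E)).
      apply/integrableP; split; first by apply/measurable_EFinP; exact: measurable_indic.
      rewrite (eq_integral (fun y => (\1_(B m) y)%:E)).
        by rewrite integral_indic// setIT.
      by move=> y _; rewrite gee0_abs// lee_fin indicE.
  have ip : mu.-integrable setT (fun y => (\1_(B m) y * p y)%:E).
    by apply: bounded => // y [[_ []]].
  have iq : mu.-integrable setT (fun y => (\1_(B m) y * q y)%:E).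
    by apply: bounded => // y [[_ []]].
  have sBE : B m `<=` E by move=> y [[[]]].
  have := H (B m) (mB m) sBE.
  have g0 y : 0 <= (\1_(B m) y * p y)%:E - (\1_(B m) y * q y)%:E.
    rewrite -EFinB lee_fin -mulrBr indicE.
    have [/set_mem [[[_ /= qp] _] _]|] := boolP (y \in B m); last by rewrite mul0r.
    by rewrite mul1r subr_ge0 ltW.
  rewrite -sube_le0 -(integralB measurableT ip iq) => I0.
  have mg : measurable_fun setT (fun y => (\1_(B m) y * p y)%:E - (\1_(B m) y * q y)%:E).
    by apply: emeasurable_funB; exact: mul_indic_measurable.
  have I1 : \int[mu]_y `|(\1_(B m) y * p y)%:E - (\1_(B m) y * q y)%:E| = 0.
    rewrite (eq_integral (fun y => (\1_(B m) y * p y)%:E - (\1_(B m) y * q y)%:E)).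
      by apply/le_anti; rewrite I0 integral_ge0.
    by move=> y _; rewrite gee0_abs.
  have [N [mN N0 sub]] := (ae_eq_integral_abs mu measurableT mg).1 I1.
  apply: (@subset_measure0 _ _ _ mu (B m) N) => //.
  move=> y By; apply: sub => /= /(_ I).
  have := By; move=> [[[_ /= qp] _] _].
  rewrite indicE mem_set// !mul1r -EFinB => /eqP.
  by rewrite eqe subr_eq0 gt_eqF.
exists (\bigcup_m B m); split.
- exact: bigcupT_measurable.
- apply/eqP; rewrite eq_le measure_ge0 andbT.
  apply: (le_trans (measure_sigma_subadditive _ _ _ (subset_refl _))) => //.
    exact: bigcupT_measurable.
  by rewrite eseries0// => m _ _; exact: muB.
move=> y /= /not_implyP[Ey /negP]; rewrite -ltNge => qp.
have [l _ Fl] : (\bigcup_i F i) y by rewrite -TF.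
pose m := maxn l (maxn (Num.bound `|p y|%R) (Num.bound `|q y|%R)).
have bnd (z : R) : (Num.bound `|z|%R <= m)%N -> (`|z| <= m%:R)%R.
  move=> zm; apply: (@le_trans _ _ (Num.bound `|z|%R)%:R); last by rewrite ler_nat.
  by apply/ltW/archi_boundP.
have lm : (l <= m)%N by rewrite leq_maxl.
have /subsetPset FlFm := ndF _ _ lm.
exists m => //; split; last exact: FlFm.
split=> //; split=> /=; apply: bnd.
  by rewrite /m maxnCA leq_max leqnn.
by rewrite /m maxnA leq_max leqnn orbT.
Qed.

(** Order almost everywhere follows from order of the integrals. The sequence can then fail to
    converge to [p] only on the sets [E m], where all [q n] stay below p - 1 / (m + 1). There [Qsup]
    bounds the integral of [p] by that of the smaller function, so [E m] is null. *)
Lemma ae_cvg_of_integral (n0 : nat) (q : nat -> T -> R) p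
    (Qn : nat -> set T -> \bar R) (Q : set T -> \bar R) :
  (forall n, (n0 <= n)%N -> measurable_fun setT (q n)) -> measurable_fun setT p ->
  (forall n A, (n0 <= n)%N -> measurable A -> 0 <= Qn n A) ->
  (forall n A, (n0 <= n)%N -> measurable A ->
    \int[mu]_y (\1_A y * q n y)%:E = Qn n A) ->
  (forall A, measurable A -> \int[mu]_y (\1_A y * p y)%:E = Q A) ->
  (forall n A, (n0 <= n)%N -> measurable A -> Qn n A <= Qn n.+1 A) ->
  (forall n A, (n0 <= n)%N -> measurable A -> Qn n A <= Q A) ->
  (forall A c, measurable A -> (forall n, (n0 <= n)%N -> Qn n A <= c) -> Q A <= c) ->
  {ae mu, forall y, (forall n, (n0 <= n)%N -> (q n y <= q n.+1 y)%R) /\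
    ((fun n => q n y) @ \oo --> p y)}.
Proof.
move=> mq mp Qn0 qQ pQ Qnd QnQ Qsup.
have aen (A : nat -> T -> Prop) : (forall n, (n0 <= n)%N -> {ae mu, forall y, A n y}) ->
    {ae mu, forall y, forall n, (n0 <= n)%N -> A n y}.
  move=> H; have : forall n, {ae mu, forall y, (n0 <= n)%N -> A n y}.
    move=> n; have [n0n|nn0] := leqP n0 n; first by apply: filterS (H n n0n).
    by apply: aeW.
  by move/ae_foralln.
have ae0 : {ae mu, forall y, forall n, (n0 <= n)%N -> (0 <= q n y)%R}.
  apply: aen => n n0n; apply: ae_ge0_of_integral; first exact: mq.
  by move=> A mA; rewrite qQ// Qn0.
have ae1 : {ae mu, forall y, forall n, (n0 <= n)%N -> (q n y <= q n.+1 y)%R}.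
  apply: aen => n n0n.
  have := @ae_le_of_integral (q n) (q n.+1) setT (mq _ n0n) (mq _ (leqW n0n)) measurableT.
  move=> H; apply: filterS (H _) => [y /(_ I)//|A mA _].
  by rewrite !qQ// ?Qnd// leqW.
have ae2 : {ae mu, forall y, forall n, (n0 <= n)%N -> (q n y <= p y)%R}.
  apply: aen => n n0n.
  have H := @ae_le_of_integral (q n) p setT (mq _ n0n) mp measurableT.
  apply: filterS (H _) => [y /(_ I)//|A mA _].
  by rewrite qQ// pQ// QnQ.
(* Nonnegativity of [q n] is built in so that integrals over subsets of [E m] can be compared by
   [ge0_le_integral]. *)
pose E (m : nat) := \bigcap_(n in [set n | (n0 <= n)%N])
  ([set y | (0 <= q n y)%R] `&` [set y | (q n y <= p y - m.+1%:R^-1)%R]).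
have mle (f g : T -> R) : measurable_fun setT f -> measurable_fun setT g ->
    measurable [set y | (f y <= g y)%R].
  move=> mf mg; rewrite (_ : mkset _ = ~` [set y | (g y < f y)%R]).
    by apply: measurableC; exact: measurable_lt_set.
  by apply/seteqP; split=> y /=; rewrite leNgt => /negP.
have mpm (m : nat) : measurable_fun setT (fun y => p y - m.+1%:R^-1)%R.
  exact: measurable_funB.
have ae3 m : {ae mu, forall y, ~ E m y}.
  have mE : measurable (E m).
    apply: bigcap_measurable; first by exists n0 => /=.
    move=> n /= n0n; apply: measurableI; apply: mle => //; exact: mq.
  have H := @ae_le_of_integral p (fun y => p y - m.+1%:R^-1)%R (E m) mp (mpm m) mE.
  apply: filterS (H _) => [y Hy Ey|A mA AE].
    have := Hy Ey; rewrite leNgt => /negP; apply.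
    by rewrite ltrBlDr ltrDl invr_gt0.
  rewrite pQ//; apply: Qsup => // n n0n; rewrite -qQ//.
  apply: ge0_le_integral => //.
  - move=> y _; rewrite lee_fin indicE; have [/set_mem yA|] := boolP (y \in A).
      by rewrite mul1r; have [] := AE y yA n n0n.
    by rewrite mul0r.
  - by apply: mul_indic_measurable => //; exact: mq.
  - exact: mul_indic_measurable.
  move=> y _; rewrite lee_fin indicE; have [/set_mem yA|] := boolP (y \in A).
    by rewrite !mul1r; have [] := AE y yA n n0n.
  by rewrite !mul0r.
have /ae_foralln ae4 := ae3.
apply: filterS2 (filterI ae0 ae1) (filterI ae2 ae4) => y [y0 y1] [y2 y4].
split; first exact: y1.
have nd n n' : (n0 <= n)%N -> (n <= n')%N -> (q n y <= q n' y)%R.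
  move=> n0n; elim: n' => [|n' IH]; first by rewrite leqn0 => /eqP ->.
  rewrite leq_eqVlt => /orP[/eqP ->//|nn'].
  by apply: le_trans (IH nn') (y1 _ _); exact: leq_trans n0n nn'.
apply/cvgrPdist_lt => e e0.
pose m := Num.bound (e^-1).
have me : (m.+1%:R^-1 < e)%R.
  rewrite invf_plt ?posrE//; apply: (@lt_trans _ _ m%:R); last by rewrite ltr_nat.
  by apply: archi_boundP; rewrite invr_ge0 ltW.
have [n n0n qn] : exists2 n, (n0 <= n)%N & (p y - m.+1%:R^-1 < q n y)%R.
  apply: contrapT => nex; apply: (y4 m) => n /= n0n; split => /=; first exact: y0.
  by rewrite leNgt; apply/negP => h; apply: nex; exists n.
exists n => // n' /= nn'; have n0n' := leq_trans n0n nn'.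
have h1 := y2 n' n0n'; have h2 := nd n n' n0n nn'.
rewrite ger0_norm ?subr_ge0//; move: me qn h1 h2; set v := (m.+1%:R^-1)%R.
by clear; lra.
Qed.

End DensityComparison.

Section NonMeasurableIntegrands.
Context {R : realType} {d} {T : measurableType d}.
Context (mu : {measure set T -> \bar R}).
Local Open Scope ereal_scope.

(* The sum over the image of the flow is not known to be measurable in [w];
   the integral of a nonnegative function is then a lower integral. *)
Lemma le_integral_ge0 (f g : T -> \bar R) : (forall x, 0 <= f x) ->
  (forall x, f x <= g x) -> \int[mu]_x f x <= \int[mu]_x g x.
Proof.
move=> f0 fg; rewrite !ge0_integralTE//; last by move=> x; exact: le_trans (fg x).
apply: le_ereal_sup => _ [h hf <-]; exists h => // x.
exact: le_trans (hf x) (fg x).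
Qed.

(** Raising [g] to +oo on a measurable null set makes the inequality hold everywhere and changes
    only the measurable side. *)
Lemma ae_le_integral_ge0 (f g : T -> \bar R) : (forall x, 0 <= f x) ->
  (forall x, 0 <= g x) -> measurable_fun setT g ->
  {ae mu, forall x, f x <= g x} -> \int[mu]_x f x <= \int[mu]_x g x.
Proof.
move=> f0 g0 mg [N [mN N0 sub]].
pose g' x := if x \in N then +oo else g x.
have mN' : measurable_fun setT (fun x => x \in N).
  apply: (measurable_fun_bool true); rewrite setTI.
  rewrite (_ : _ @^-1` _ = N)//.
  by apply/seteqP; split=> w /=; [move/set_mem|move/mem_set ->].
have mg' : measurable_fun setT g' by exact: measurable_fun_ifT.
apply: (@le_trans _ _ (\int[mu]_x g' x)).
  apply: le_integral_ge0 => // x; rewrite /g'; case: ifPn => [_|xN]; first exact: leey.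
  by apply: contrapT => nfg; move: xN; rewrite mem_set//; exact: sub.
rewrite (ge0_ae_eq_integral measurableT mg' mg)//.
  by move=> x _; rewrite /g'; case: ifP.
exists N; split => // x; apply: contra_notP => xN _.
by rewrite /g' memNset.
Qed.

End NonMeasurableIntegrands.

(** * Summing the densities over all schemes *)

Section SchemeDensities.
Context {R : realType} {d} {Omega : measurableType d} (P : probability Omega R).
Context (X : R -> R -> Omega -> R) (t : R) (k n : nat) (U : n.-tuple R).
Hypothesis flow : arratia_flow P X.
Hypothesis t_ge0 : 0 <= t.
Hypothesis U01 : {in U, forall u, 0 <= u <= 1}.
Local Open Scope ereal_scope.

Definition image_mass (A : set (k.-tuple R)) (w : Omega) : \bar R :=
  \esum_(v in @distinct_tuples R k [set X u t w | u in [set` U]]) (\1_A v)%:E.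

Lemma image_mass_ge0 A w : 0 <= image_mass A w.
Proof. by apply: esum_ge0 => v _; rewrite lee_fin indicE. Qed.

Lemma measurable_image_mass A : measurable A ->
  measurable_fun setT (image_mass A).
Proof.
move=> mA; pose Y (i : 'I_n) w := X (tnth U i) t w.
have mY i : measurable_fun setT (Y i).
  by apply: (af_measurable flow) => //; apply: U01; exact: mem_tnth.
rewrite (_ : image_mass A = fun w => \esum_(y in @distinct_tuples R k (range (Y ^~ w))) (\1_A y)%:E).
  exact: measurable_esum_distinct_tuples.
apply/funext => w; rewrite /image_mass; congr (esum (distinct_tuples _) _).
apply/seteqP; split=> v /=.
  by move=> [u /tnthP[i ->] <-]; exists i.
by move=> [i _ <-]; exists (tnth U i) => //=; exact: mem_tnth.
Qed.

Definition relevant_schemes : seq (seq nat) :=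
  flatten [seq schemes n (n - i) | i <- index_iota k n.+1].

Lemma relevant_schemesP J : reflect
  (exists2 l, (k <= l <= n)%N & J \in schemes n (n - l))
  (J \in relevant_schemes).
Proof.
apply: (iffP flatten_mapP) => [[l]|[l lkn Jl]].
  by rewrite mem_index_iota ltnS => lkn Jl; exists l.
by exists l; rewrite ?mem_index_iota ?ltnS.
Qed.

(** Schemes of different levels have different lengths: n - i determines i because i <= n. *)
Lemma relevant_schemes_uniq : uniq relevant_schemes.
Proof.
rewrite /relevant_schemes.
have : {in index_iota k n.+1, forall i, (i <= n)%N}.
  by move=> i; rewrite mem_index_iota ltnS => /andP[].
have := iota_uniq k (n.+1 - k); rewrite -/(index_iota k n.+1).
elim: (index_iota k n.+1) => [//|i s IH] /= /andP [nis us] sn.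
rewrite cat_uniq schemes_uniq IH//=; last first.
  by move=> j js; apply: sn; rewrite in_cons js orbT.
rewrite andbT; apply/hasPn => J /flatten_mapP[j js Jj]; apply/negP => Ji.
have := size_schemes Jj; rewrite (size_schemes Ji).
have ni : (i <= n)%N by apply: sn; rewrite in_cons eqxx.
have nj : (j <= n)%N by apply: sn; rewrite in_cons js orbT.
move=> e; have ij : i = j by lia.
by move: nis; rewrite ij js.
Qed.

Lemma sum_schemesE (pJ : seq nat -> k.-tuple R -> R) y :
  sum_schemes n pJ y = (\sum_(J <- relevant_schemes) pJ J y)%R.
Proof. by rewrite /sum_schemes /relevant_schemes big_flatten big_map. Qed.

Let scheme w := coalescence_scheme t (trajectories X U w).

(** In [scheme_point_density] the indicator of the scheme stands under the sum over tuples. *)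
Let image_mass_scheme A w J :
  \esum_(v in @distinct_tuples R k [set X u t w | u in [set` U]])
     ((\1_A v)%:E * ((scheme w == J)%:R)%:E) =
  image_mass A w * ((scheme w == J)%:R)%:E.
Proof.
case: (_ == J); last first.
  by rewrite mule0 esum1// => v _; rewrite mule0.
by rewrite mule1; apply: eq_esum => v _; rewrite mule1.
Qed.

(** A nonzero mass exhibits a [k]-tuple of distinct values, so at least [k] of them remain at time
    [t]. *)
Lemma scheme_relevant A w : image_mass A w != 0 -> scheme w \in relevant_schemes.
Proof.
move=> mass0.
have cX : forall (u : R) w', (0 <= u <= 1)%R ->
    {within `[0%R, +oo[, continuous (fun s => X u s w')}.
  by move=> u w' u01; have [_ _ _ H _] := flow; exact: H.
have valE : [seq y t | y <- trajectories X U w] = [seq X u t w | u <- U].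
  by rewrite -map_comp.
have := coalescence_scheme_mem t_ge0 (continuous_trajectories cX (w := w) U01).
rewrite size_trajectories size_tuple valE => mem.
apply/relevant_schemesP; exists (size (undup [seq X u t w | u <- U])) => //.
apply/andP; split; last first.
  by rewrite -[X in (_ <= X)%N](size_tuple U) -(size_map (fun u => X u t w)) size_undup.
rewrite leqNgt; apply: contra_neqN mass0 => kl.
apply: esum1 => v [uv Sv]; exfalso.
have : (size v <= size (undup [seq X u t w | u <- U]))%N.
  apply: uniq_leq_size => // y /tnthP[i ->].
  by rewrite mem_undup; have [u uU <-] := Sv i; exact: map_f.
by rewrite size_tuple leqNgt kl.
Qed.

Let measurable_scheme J : measurable [set w | scheme w = J].
Proof.
apply: measurable_coalescence_scheme => //.
  by move=> u s u01 s0; exact: (af_measurable flow).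
by move=> u w u01; have [_ _ _ H _] := flow; exact: H.
Qed.

Let measurable_mass_scheme A J : measurable A ->
  measurable_fun setT (fun w => image_mass A w * ((scheme w == J)%:R)%:E).
Proof.
move=> mA; apply: emeasurable_funM; first exact: measurable_image_mass.
rewrite (_ : (fun w => _) = fun w => (\1_[set w | scheme w = J] w)%:E).
  by apply/measurable_EFinP; exact: measurable_indic.
apply/funext => w; rewrite indicE; congr ((_ %:R)%:E); congr nat_of_bool.
by apply/eqP/idP => [|/set_mem//]; move=> h; exact/mem_set.
Qed.

Lemma sum_image_mass A : measurable A ->
  \sum_(J <- relevant_schemes) (\int[P]_w
    (\esum_(v in @distinct_tuples R k [set X u t w | u in [set` U]])
       ((\1_A v)%:E * ((scheme w == J)%:R)%:E))) =
  \int[P]_w image_mass A w.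
Proof.
move=> mA.
under eq_bigr do under eq_integral do rewrite image_mass_scheme.
have mJ J := @measurable_mass_scheme A J mA.
have J0 J w : setT w -> 0 <= image_mass A w * ((scheme w == J)%:R)%:E.
  by rewrite mule_ge0 ?image_mass_ge0.
rewrite -ge0_integral_sum//.
apply: eq_integral => w _.
have [->|mass0] := eqVneq (image_mass A w) 0.
  by rewrite big1// => J _; rewrite mul0e.
rewrite -ge0_sume_distrr//.
rewrite sumEFin -natr_sum.
(* Where the mass is nonzero, the scheme occurs exactly once in the list. *)
rewrite (_ : (\sum_(J <- _) _)%N = 1%N) ?mule1//.
rewrite -[in RHS](_ : count_mem (scheme w) relevant_schemes = 1%N); last first.
  by rewrite count_uniq_mem ?relevant_schemes_uniq// (scheme_relevant mass0).
rewrite -sum1_count [RHS]big_mkcond; apply: eq_bigr => J _ /=.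
by rewrite eq_sym; case: (_ == _).
Qed.

Lemma integral_sum_schemes (pJ : seq nat -> k.-tuple R -> R) :
  (forall l J, (k <= l <= n)%N -> J \in schemes n (n - l) ->
    scheme_point_density P X t U J (pJ J)) ->
  measurable_fun setT (sum_schemes n pJ) /\
  forall A, measurable A ->
    \int[lebesgue_tuple R k]_y (\1_A y * sum_schemes n pJ y)%:E =
    \int[P]_w image_mass A w.
Proof.
move=> dens.
have densJ J : J \in relevant_schemes -> scheme_point_density P X t U J (pJ J).
  by move=> /relevant_schemesP[l lkn Jl]; exact: dens lkn Jl.
pose pp J (y : k.-tuple R) : R := Num.max 0%R (pJ J y).
(* Nothing is known of [pJ] at other sequences; the value 0 makes [q J] measurable for every [J]. *)
pose q J := if J \in relevant_schemes then pJ J else cst 0%R.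
have mq J : measurable_fun setT (q J).
  by rewrite /q; case: ifPn => // /densJ[].
have sumE y : sum_schemes n pJ y = (\sum_(J <- relevant_schemes) q J y)%R.
  rewrite sum_schemesE !big_seq; apply: eq_bigr => J rJ.
  by rewrite /q rJ.
have ind_dens J A : J \in relevant_schemes -> measurable A ->
    \int[lebesgue_tuple R k]_y (\1_A y * q J y)%:E =
    \int[P]_w (\esum_(v in @distinct_tuples R k [set X u t w | u in [set` U]])
       ((\1_A v)%:E * ((scheme w == J)%:R)%:E)).
  move=> rJ mA; have [_ H] := densJ J rJ; rewrite /q rJ.
  rewrite H//.
  by exists 1%R => y; rewrite indicE; case: (_ \in _).
have q0 J : J \in relevant_schemes -> {ae lebesgue_tuple R k, forall y, (0 <= q J y)%R}.
  move=> rJ; apply: ae_ge0_of_integral => // A mA; rewrite ind_dens//.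
  apply: integral_ge0 => w _; rewrite image_mass_scheme.
  by rewrite mule_ge0 ?image_mass_ge0.
have msum : measurable_fun setT (sum_schemes n pJ).
  rewrite (_ : sum_schemes n pJ = fun y => (\sum_(J <- relevant_schemes) q J y)%R).
    exact: measurable_sum.
  exact/funext.
split=> // A mA.
rewrite -sum_image_mass//.
have mqp J : measurable_fun setT (fun y => (\1_A y * Num.max 0 (q J y))%:E).
  apply/measurable_EFinP; apply: measurable_funM => //.
  exact: measurable_maxr.
have mqA J : measurable_fun setT (fun y => (\1_A y * q J y)%:E).
  by apply/measurable_EFinP; apply: measurable_funM.
have q0all : {ae lebesgue_tuple R k, forall y, forall J, J \in relevant_schemes -> (0 <= q J y)%R}.
  have : forall i : nat, {ae lebesgue_tuple R k, forall y,
      (i < size relevant_schemes)%N -> (0 <= q (nth [::] relevant_schemes i) y)%R}.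
    move=> i; have [ir|] := ltnP i (size relevant_schemes); last by move=> _; apply: aeW.
    by apply: filterS (q0 _ (mem_nth [::] ir)).
  move=> /ae_foralln; apply: filterS => y H J rJ.
  by rewrite -(nth_index [::] rJ); apply: H; rewrite index_mem.
(* Positive parts permit termwise integration; they agree with the densities almost everywhere. *)
transitivity (\int[lebesgue_tuple R k]_y
    \sum_(J <- relevant_schemes) (\1_A y * Num.max 0 (q J y))%:E).
  apply: ae_eq_integral => //.
  - by apply/measurable_EFinP; apply: measurable_funM.
  - exact: emeasurable_sum.
  apply: filterS q0all => y H _.
  rewrite sumEFin sumE -mulr_sumr; congr ((_ * _)%:E).
  rewrite !big_seq; apply: eq_bigr => J rJ.
  by rewrite max_r// H.
rewrite ge0_integral_sum//; last first.
  by move=> J y _; rewrite lee_fin mulr_ge0 ?indicE// le_max lexx.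
rewrite !big_seq; apply: eq_bigr => J rJ; rewrite -ind_dens//.
apply: ae_eq_integral => //; apply: filterS (q0 J rJ) => y H _.
by rewrite max_r.
Qed.

End SchemeDensities.

Theorem theorem3p2 (R : realType) (d : measure_display)
    (Omega : measurableType d) (P : probability Omega R)
    (X : R -> R -> Omega -> R) (t : R) (U : forall n : nat, n.-tuple R)
    (k : nat) (p : k.-tuple R -> R)
    (pJ : forall n : nat, seq nat -> k.-tuple R -> R) :
  arratia_flow P X ->
  0 < t <= 1 ->
  (forall n, (2 <= n)%N -> sorted <%R (U n)) ->
  (forall n, (2 <= n)%N -> nth 0 (U n) 0 = 0) ->
  (forall n, (2 <= n)%N -> nth 0 (U n) n.-1 = 1) ->
  (forall n, (2 <= n)%N -> {subset U n <= U n.+1}) ->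
  (fun n => \big[Num.max/0]_(j < n.-1) (nth 0 (U n) j.+1 - nth 0 (U n) j))
    @ \oo --> 0 ->
  (0 < k)%N ->
  point_density P X t p ->
  (forall n l J, (2 <= n)%N -> (k <= l <= n)%N -> J \in schemes n (n - l) ->
    scheme_point_density P X t (U n) J (pJ n J)) ->
  {ae lebesgue_tuple R k, forall y,
    (forall n, (maxn k 2 <= n)%N ->
      sum_schemes n (pJ n) y <= sum_schemes n.+1 (pJ n.+1) y) /\
    (fun n => sum_schemes n (pJ n) y) @ \oo --> p y}.
Proof.
move=> flow /andP[t0 t1] U_sorted U_first U_last U_sub U_mesh k0 [mp pE] dens.
have n2 n : (maxn k 2 <= n)%N -> (2 <= n)%N by rewrite geq_max => /andP[].
have U01 n : (2 <= n)%N -> {in U n, forall u, 0 <= u <= 1}.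
  by move=> ? u; exact: (partition_itv U_sorted U_first U_last).
have qE n (kn : (maxn k 2 <= n)%N) := integral_sum_schemes flow (ltW t0)
  (U01 n (n2 n kn)) (fun l J => dens n l J (n2 n kn)).
have mono n n' A w : (2 <= n)%N -> (n <= n')%N ->
    (image_mass X t (U n) A w <= image_mass X t (U n') A w)%E.
  move=> ? nn'; apply: esum_subset; apply: distinct_tuples_subset => _ [u un <-].
  by exists u => //=; exact: (partition_subset U_sub _ nn').
have mass_flow n A w : (2 <= n)%N -> (image_mass X t (U n) A w <=
    \esum_(v in @distinct_tuples R k (flow_image X t w)) (\1_A v)%:E)%E.
  move=> ?; apply: esum_subset; apply: distinct_tuples_subset => _ [u un <-].
  by exists u => //=; rewrite in_itv/=; exact: U01 un.
have mmass n A : (2 <= n)%N -> measurable A ->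
    measurable_fun setT (image_mass X t (U n) (k := k) A).
  by move=> ? mA; apply: (measurable_image_mass flow (ltW t0)) => //; exact: U01.
apply: (@ae_cvg_of_integral _ _ _ (lebesgue_tuple R k) (maxn k 2) _ p
  (fun n A => \int[P]_w image_mass X t (U n) A w)%E
  (fun A => \int[P]_w \esum_(v in @distinct_tuples R k (flow_image X t w)) (\1_A v)%:E)%E) => //.
- by move=> n /qE[].
- by move=> n A _ mA; apply: integral_ge0 => w _; exact: image_mass_ge0.
- by move=> n A /qE[_]; apply.
- move=> A mA; rewrite pE//.
  by exists 1 => y; rewrite indicE; case: (_ \in _).
- move=> n A kn mA; apply: le_integral_ge0 => w; first exact: image_mass_ge0.
  by apply: mono => //; exact: n2.
- move=> n A kn mA; apply: le_integral_ge0 => w; first exact: image_mass_ge0.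
  by apply: mass_flow; exact: n2.
(* The last condition: a common bound of the partition expectations also bounds the expectation for
   the whole flow, by monotone convergence along the nested partitions and almost sure
   stabilisation. *)
move=> A c mA Qc.
pose G n w := image_mass X t (U (n + maxn k 2)) (k := k) A w.
have G2 n : (2 <= n + maxn k 2)%N by apply: n2; exact: leq_addl.
have Gnd w : {homo G ^~ w : n n' / (n <= n')%N >-> (n <= n')%E}.
  by move=> n n' nn'; apply: mono => //; rewrite leq_add2r.
have Glim w : limn (G ^~ w) = ereal_sup (range (G ^~ w)).
  by apply/cvg_lim => //; exact: ereal_nondecreasing_cvgn.
have mG n : measurable_fun setT (G n) by exact: mmass.
have G0 n w : setT w -> (0 <= G n w)%E by move=> _; exact: image_mass_ge0.
have cvgG := cvg_monotone_convergence measurableT mG G0 (fun w _ => Gnd w).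
have mlim : measurable_fun setT (fun w => limn (G ^~ w)).
  apply: (emeasurable_fun_cvg G) => // w _; rewrite Glim.
  exact: ereal_nondecreasing_cvgn.
apply: (@le_trans _ _ (\int[P]_w limn (G ^~ w))%E).
  apply: ae_le_integral_ge0 => //.
  - by move=> w; apply: esum_ge0 => v _; rewrite lee_fin indicE.
  - by move=> w; rewrite Glim; apply: (le_trans (G0 0%N w I)); apply: ereal_sup_ubound; exists 0%N.
  apply: filterS (flow_image_stable flow t0 U_sorted U_first U_last U_sub U_mesh) => w.
  (* The index [n1 + maxn k 2] lies past the stabilisation at [n1] and is the one used by [G n1]. *)
  move=> [n1 n12 stable]; rewrite Glim (stable (n1 + maxn k 2)%N); last exact: leq_addr.
  by apply: ereal_sup_ubound; exists n1.
rewrite -(cvg_lim _ (cvgG P))//; apply: lime_le; first by apply/cvg_ex; eexists; exact: cvgG P.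
by apply: nearW => n; apply: Qc; exact: leq_addl.
Qed.
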